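(* There is a function $\varepsilon:\mathbb{Z}_{\ge 1}\to\mathbb{R}$ with $\varepsilon(t)\to 0$ as $t\to\infty$ such that for all integers $t\ge 1$ and $n\ge 1$, every graph on $n$ vertices with no $K_t$-subdivision has at most $2^{1.817\,t+\varepsilon(t)\,t}\, n$ cliques. (That is, at most $2^{1.817t+o(t)}n$ cliques.)
   Context: Graphs are finite and simple. A clique of $G$ is a set of pairwise adjacent vertices of $G$ (the empty set and single vertices count as cliques); the number of cliques is the number of such sets. An $H$-subdivision in $G$ is a one-to-one mapping $\phi: V(H)\to V(G)$ together with a collection of paths in $G$, one for each edge $uv$ of $H$, the path for $uv$ having end vertices $\phi(u)$ and $\phi(v)$, such that no internal vertex of any path lies in $\phi(V(H))$ and the paths are pairwise internally vertex-disjoint. $K_t$ is the complete graph on $t$ vertices. *)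

(* Defs.v *)
From mathcomp Require Import all_boot.

Set Implicit Arguments.
Unset Strict Implicit.
Unset Printing Implicit Defensive.

Record sgraph := SGraph {
  vertex :> finType;
  adj : rel vertex;
  adj_sym : symmetric adj;
  adj_irr : irreflexive adj
}.

Definition cliques (G : sgraph) : {set {set G}} :=
  [set A : {set G} | [forall x in A, forall y in A, (x != y) ==> adj x y]].

Section CompleteGraph.
Variable t : nat.

Definition complete_adj : rel 'I_t := fun i j => i != j.

Lemma complete_sym : symmetric complete_adj.
Proof. by move=> i j; rewrite /complete_adj eq_sym. Qed.

Lemma complete_irr : irreflexive complete_adj.
Proof. by move=> i; rewrite /complete_adj eqxx. Qed.

Definition complete_graph : sgraph := SGraph complete_sym complete_irr.

End CompleteGraph.

(* The vertices x, s_1, ..., s_k, y form, in this order, a path of G; its list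
   of internal vertices is s (empty when the path is the single edge xy). *)
Definition is_path (G : sgraph) (x : G) (s : seq G) (y : G) : bool :=
  path (@adj G) x (rcons s y) && uniq (x :: rcons s y).

(* The paths are indexed by ordered pairs of adjacent vertices of H: P u v lists
   the internal vertices of the path for the edge uv, read from phi u to phi v.
   The condition P v u = rev (P u v) makes it one path per unordered edge; the
   values of P on non-adjacent pairs are irrelevant. *)
Record is_subdivision (H G : sgraph) (phi : H -> G) (P : H -> H -> seq G) :
    Prop := IsSubdivision {
  subdiv_inj : injective phi;
  subdiv_path : forall u v, adj u v -> is_path (phi u) (P u v) (phi v);
  subdiv_rev : forall u v, adj u v -> P v u = rev (P u v);
  subdiv_internal : forall u v w, adj u v -> phi w \notin P u v;
  subdiv_disjoint : forall u v x y, adj u v -> adj x y ->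
    [set u; v] != [set x; y] -> ~~ has (mem (P u v)) (P x y)
}.

Definition has_subdivision (H G : sgraph) : Prop :=
  exists (phi : H -> G) (P : H -> H -> seq G), is_subdivision phi P.

(* Main.v *)
(* A graph with no K_t-subdivision is D-degenerate with D polynomial in t: a subgraph of
   huge minimum degree contains a highly connected one (Mader), which has a large clique
   minor (contract edges lying in few triangles until some neighbourhood is dense), and
   through this minor the t(t-1) leaves of t disjoint stars can be linked in any prescribed
   pairs (Robertson and Seymour, using Menger's theorem).  So it suffices to count the
   cliques inside a set V of at most D vertices.

   First decide, one at a time, the vertices with at least |V|/1000 non-neighbours in V:
   each one that is put into the clique shrinks V by a constant factor, so at most
   O(log D) of them are, which costs a factor 2^(o(t)).  Any two of the remaining
   candidates have almost |V| common neighbours, so t of them spanning fewer than about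
   |V| - t non-adjacent pairs would be the branch vertices of a K_t-subdivision.  By
   averaging, every set of m > t candidates therefore has a vertex with about
   x = 2(|V| - t)m/t^2 non-neighbours in it.  Branching on that vertex gives
   f(m) <= f(m-1) + f(m-1-x), whence log f(m) - log f(m-1) <= min(ln 2, x^(-2/3)).  With
   c = |V|/t this sums to at most t ln 2 + 3 (2(c-1))^(-2/3) (c^(1/3) - 1) t, which is
   below 1.78 t ln 2 for every c > 1; the slack up to 1.817 absorbs the constant 1000. *)
Require Import Defs.
From mathcomp Require Import all_boot all_order all_algebra.
From mathcomp Require Import ring lra zify.

Set Implicit Arguments.
Unset Strict Implicit.
Unset Printing Implicit Defensive.

(** * Connected sets *)

(** The count carries two sets: the candidates M, in which cliques are counted, and the host V. A
    vertex rejected from the clique leaves M but stays in V, where it can still subdivide a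
    non-adjacent pair. Hence the number of non-adjacent pairs forced on t candidates depends on |V|,
    however much M has shrunk. If |V| <= 9t/5, the trivial bound 2^|V| is small enough; beyond that,
    |V| - t is a fixed fraction of |V|, so the non-neighbours tolerated by the constant 1000 change
    it by a small factor only. The error term: with D < 2^k, at most 999k vertices enter the clique
    before V is exhausted, and each choice costs a factor of at most 2^k, in all 2^(999k^2). Any k =
    o(sqrt t) would do; here k = O(t^(1/4)), which avoids logarithms. *)

Definition within (T : finType) (e : rel T) (X : {set T}) : rel T :=
  [rel a b | [&& e a b, a \in X & b \in X]].

Definition conn (T : finType) (e : rel T) (X : {set T}) : Prop :=
  {in X &, forall x y, connect (within e X) x y}.

Section Connectivity.
Variable T : finType.
Implicit Types (e : rel T) (X Y U : {set T}).

Lemma within_sym e X : symmetric e -> symmetric (within e X).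
Proof. by move=> es a b; rewrite /within /= es [(b \in X) && _]andbC. Qed.

Lemma connect_homo (T' : finType) e (e' : rel T') (f : T -> T') x y :
  (forall a b, e a b -> connect e' (f a) (f b)) ->
  connect e x y -> connect e' (f x) (f y).
Proof.
move=> h /connectP [p pp ->] {y}; elim: p x pp => [|a p IH] x /=.
  by rewrite connect0.
by case/andP=> /h xa /IH; apply: connect_trans.
Qed.

Lemma connect_mono e e' x y :
  (forall a b, e a b -> e' a b) -> connect e x y -> connect e' x y.
Proof.
by move=> h; apply: (@connect_homo _ e e' id) => a b /h; apply: connect1.
Qed.

Lemma closed_connect e (P : pred T) x y :
  (forall a b, P a -> e a b -> P b) -> connect e x y -> P x -> P y.
Proof.
move=> h /connectP [p pp ->] {y}; elim: p x pp => [|a p IH] x //=.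
by case/andP=> xa /IH{}IH Px; apply: IH; apply: h xa.
Qed.

Lemma closed_connect_in e X x y :
  (forall a b, a \in X -> e a b -> b \in X) ->
  connect e x y -> x \in X -> y \in X.
Proof. exact: (@closed_connect e (fun v => v \in X)). Qed.

Lemma connect_within e X x y :
  connect (within e X) x y -> x \in X -> y \in X.
Proof. by apply: closed_connect_in => a b _ /and3P []. Qed.

Lemma conn_mono e e' X :
  (forall a b, e a b -> e' a b) -> conn e X -> conn e' X.
Proof.
move=> h c x y xX yX; apply: connect_mono (c x y xX yX) => a b.
by case/and3P => /h ab aX bX; apply/and3P.
Qed.

Lemma within_sub e X Y : X \subset Y ->
  forall a b, within e X a b -> within e Y a b.
Proof. by move=> /subsetP h a b /and3P [? /h aX /h bX]; apply/and3P. Qed.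

Lemma conn1 e x : conn e [set x].
Proof. by move=> a b /set1P -> /set1P ->; apply: connect0. Qed.

Lemma connU e X Y x y : symmetric e -> conn e X -> conn e Y ->
  x \in X -> y \in Y -> (x == y) || e x y -> conn e (X :|: Y).
Proof.
move=> es cX cY xX yY xy; set W := X :|: Y.
have sXW a b : a \in X -> b \in X -> connect (within e W) a b.
  move=> aX bX; apply: connect_mono (cX a b aX bX).
  by apply: within_sub; apply: subsetUl.
have sYW a b : a \in Y -> b \in Y -> connect (within e W) a b.
  move=> aX bX; apply: connect_mono (cY a b aX bX).
  by apply: within_sub; apply: subsetUr.
have xyW : connect (within e W) x y.
  case/orP: xy => [/eqP-> | xy]; first exact: connect0.
  by apply: connect1; rewrite /within /= xy !inE xX yY orbT.
have csym := sym_connect_sym (within_sym W es).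
move=> a b /setUP [aX|aY] /setUP [bX|bY]; try by [apply: sXW | apply: sYW].
  by apply: (connect_trans (sXW a x _ _) (connect_trans xyW _)) => //; apply: sYW.
rewrite csym.
by apply: (connect_trans (sXW b x _ _) (connect_trans xyW _)) => //; apply: sYW.
Qed.

(** Menger's theorem is applied to restricted relations such as [within e V]; this confines the
    connected sets that it returns. *)
Lemma conn_support e X U a : (forall x y : T, e x y -> (x \in U) && (y \in U)) ->
  conn e X -> a \in X -> a \in U -> X \subset U.
Proof.
move=> eU cX aX aU; apply/subsetP => b bX.
apply: (closed_connect_in _ (cX a b aX bX) aU) => c d _ /and3P [cd _ _].
by case/andP: (eU _ _ cd).
Qed.

End Connectivity.

(** * Menger's theorem *)

Section Menger.
Variable T : finType.

(** The ends are asked to avoid X separately because [connect] is reflexive even at a vertex of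
    X. *)
Definition linked (e : rel T) (X A B : {set T}) : Prop :=
  exists a b : T, [/\ a \in A :\: X, b \in B :\: X & connect (within e (~: X)) a b].

Definition nedges (e : rel T) : nat := #|[set p : T * T | e p.1 p.2]|.

Lemma nedges_lt (e e' : rel T) x y :
  (forall a b, e' a b -> e a b) -> e x y -> ~~ e' x y -> nedges e' < nedges e.
Proof.
move=> h xy nxy; apply: proper_card; apply/properP; split.
  by apply/subsetP => -[a b]; rewrite !inE; apply: h.
by exists (x, y); rewrite !inE.
Qed.

(** Pigeonhole: disjoint sets that all meet P, at least |P| of them, meet it in one point each and
    exhaust it. *)
Lemma disjoint_hit (I : finType) (F : I -> {set T}) (P : {set T}) :
  (forall i j, i != j -> [disjoint F i & F j]) ->
  (forall i, exists2 p, p \in P & p \in F i) -> #|P| <= #|I| ->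
  exists2 g : I -> T, injective g &
    (forall i, F i :&: P = [set g i]) /\ (forall p, p \in P -> exists i, p = g i).
Proof.
move=> dF hF cP.
have [g gP] : exists g : I -> T, forall i, (g i \in P) && (g i \in F i).
  suff h i : {p | (p \in P) && (p \in F i)}.
    by exists (fun i => sval (h i)) => i; apply: (svalP (h i)).
  by apply: sigW; have [p pP pF] := hF i; exists p; rewrite pP.
have gi : injective g.
  move=> i j gij; apply/eqP; apply: contraT => /dF /pred0P /(_ (g i)) /=.
  by case/andP: (gP i) => _ ->; rewrite gij; case/andP: (gP j) => _ ->.
have surj p : p \in P -> exists i, p = g i.
  suff /setP h : g @: I = P by rewrite -h => /imsetP [i _ ->]; exists i.
  apply/eqP; rewrite eqEcard card_imset //= cP andbT.
  by apply/subsetP => _ /imsetP [i _ ->]; case/andP: (gP i).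
exists g => //; split => // i; apply/setP => p; rewrite !inE.
apply/andP/eqP => [[pF pP]|->]; last by case/andP: (gP i).
have [j pj] := surj p pP; rewrite pj; congr g; apply/eqP; apply: contraT => ji.
move/pred0P: (dF j i ji) => /(_ p) /=; rewrite pF andbT pj.
by case/andP: (gP j) => _ ->.
Qed.

(** Only trivial paths exist, so A :&: B is itself a separator and has at least k elements. *)
Lemma menger_edgeless (e : rel T) (k : nat) (A B : {set T}) :
  (forall a b, e a b -> a = b) ->
  (forall X : {set T}, #|X| < k -> linked e X A B) ->
  exists F : 'I_k -> {set T},
    [/\ forall i, conn e (F i), forall i j, i != j -> [disjoint F i & F j],
        forall i, exists2 a, a \in A & a \in F i &
        forall i, exists2 b, b \in B & b \in F i].
Proof.
move=> ne hs.
have kAB : k <= #|A :&: B|.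
  rewrite leqNgt; apply/negP => /hs [a [b [aA bB ab]]].
  have {}ab : b = a.
    apply/eqP; apply: (@closed_connect _ _ (pred1 a) _ _ _ ab) => //=.
    by move=> c d /eqP -> /and3P [/ne->].
  by move: aA bB; rewrite ab !inE => /andP [/negP h aA] /andP [_ aB]; apply: h; rewrite aA.
have [g gP gi] : exists2 g : 'I_k -> T, forall i, g i \in A :&: B & injective g.
  exists (fun i => enum_val (widen_ord kAB i)); first by move=> i; apply: enum_valP.
  by move=> i j /enum_val_inj /(congr1 val) /= ij; apply: val_inj.
exists (fun i => [set g i]); split.
- by move=> i; apply: conn1.
- by move=> i j ij; rewrite disjoints1 inE (inj_eq gi).
- by move=> i; exists (g i); rewrite ?inE //; have := gP i; rewrite inE => /andP [].
- by move=> i; exists (g i); rewrite ?inE //; have := gP i; rewrite inE => /andP [].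
Qed.

(** R is the side of A once S and one edge are removed: it contains A off S, misses B, and xy is the
    only edge from R to the outside of R :|: S. *)
Definition gap (e : rel T) (A B S R : {set T}) (x y : T) : Prop :=
  [/\ e x y, x \in R, y \notin R :|: S,
      forall v, v \in R -> (v \notin S) && (v \notin B) &
      (forall a, a \in A -> a \notin S -> a \in R) /\
      (forall v w, v \in R -> w \notin R :|: S -> e v w -> (v == x) && (w == y))].

(** R consists of the vertices that e' reaches from A off S. A path of e from A to B off S must
    leave R, and only the deleted edge can do that, in one of its two directions; hence the
    existential [v] and [w]. *)
Lemma gap_exists (e e' : rel T) (A B S : {set T}) x y : symmetric e ->
  (forall a b, e a b -> e' a b \/ (a = x /\ b = y) \/ (a = y /\ b = x)) ->
  linked e S A B -> ~ linked e' S A B ->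
  exists R v w, gap e A B S R v w.
Proof.
move=> es ee' [a [b [aA bB ab]]] ns.
pose R := [set v | [exists a in A :\: S, connect (within e' (~: S)) a v]]; exists R.
have RS v : v \in R -> (v \notin S) && (v \notin B).
  rewrite inE => /exists_inP [c cA cv]; have vS : v \notin S.
    by move: (connect_within cv); rewrite !inE; move: cA; rewrite inE => /andP [-> _]; apply.
  by rewrite vS; apply/negP => vB; apply: ns; exists c, v; split=> //; rewrite inE vS.
have AR c : c \in A -> c \notin S -> c \in R.
  by move=> cA cS; rewrite inE; apply/exists_inP; exists c; rewrite ?inE ?cS ?connect0.
have Rcl v w : v \in R -> w \notin R :|: S -> e' v w -> False.
  move=> vR wR vw; move: wR; rewrite inE negb_or => /andP [wR wS].
  case/negP: wR; have /andP [vS _] := RS v vR; move: vR.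
  rewrite !inE => /exists_inP [c cA cv]; apply/exists_inP; exists c => //.
  by apply: connect_trans cv _; apply: connect1; rewrite /within /= vw !inE vS wS.
have aR : a \in R by apply: AR; move: aA; rewrite inE => /andP [].
have bR : b \notin R by apply/negP => /RS; move: bB; rewrite inE => /andP [_ ->]; rewrite andbF.
have [v [w [vR wR vw]]] : exists v w, [/\ v \in R, w \notin R :|: S & e v w].
  have [/existsP [v /existsP [w /and3P [? ? ?]]]|h] :=
    boolP [exists v, exists w, [&& v \in R, w \notin R :|: S & e v w]]; first by exists v, w.
  case/negP: bR; apply: (closed_connect_in _ ab aR) => v w vR /and3P [vw _].
  rewrite inE => wS; apply: contraNT h => wR; apply/existsP; exists v.
  by apply/existsP; exists w; apply/and3P; split=> //; rewrite inE negb_or wR.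
exists v, w; split => //; split=> // v' w' vR' wR' vw'.
have nvR u u' : u \in R -> u' \notin R :|: S -> u != u'.
  by move=> uR; apply: contraNneq => <-; rewrite inE uR.
have nR u : u \notin R :|: S -> u \notin R by rewrite inE negb_or => /andP [].
case: (ee' _ _ vw) => [/(Rcl _ _ vR wR)//|]; case: (ee' _ _ vw') => [/(Rcl _ _ vR' wR')//|].
case=> [][E1 E2] [][E3 E4]; rewrite E1 E2 E3 E4 ?eqxx //.
  by move: (nR _ wR); rewrite E4 -E1 vR'.
by move: (nR _ wR); rewrite E4 -E1 vR'.
Qed.

Lemma gap_separator (e : rel T) (A B S R : {set T}) x y :
  gap e A B S R x y -> ~ linked e (x |: S) A B.
Proof.
case=> xy xR yRS RSB [AR Rout] [a [b [aA bB ab]]].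
have aR : a \in R.
  by move: aA; rewrite !inE negb_or => /andP [/andP [_ aS] aA]; apply: AR.
suff bR : b \in R by case/andP: (RSB b bR) => _; move: bB; rewrite inE => /andP [_ ->].
apply: (closed_connect_in _ ab aR) => v w vR /and3P [vw].
rewrite !inE !negb_or => /andP [vx vS] /andP [wx wS]; apply: contraT => wR.
by have := Rout v w vR _ vw; rewrite inE negb_or wR wS (negPf vx) => /(_ isT).
Qed.

(** Follow the path from A: it stays in R until it meets x |: S, since the only way out of R
    avoiding S starts at x. *)
Lemma gap_linked1 (e : rel T) (A B S R X : {set T}) x y :
  gap e A B S R x y -> linked e X A B ->
  linked (within e (R :|: S)) X A (x |: S).
Proof.
case=> xy xR yRS RSB [AR Rout] [a [b [aA bB ab]]].
have aX : a \notin X by move: aA; rewrite inE => /andP [].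
have [aS|aS] := boolP (a \in S).
  by exists a, a; split=> //; rewrite ?connect0 // !inE aS aX orbT.
have aR : a \in R by apply: AR => //; move: aA; rewrite inE => /andP [].
pose P v := (v \in R) && connect (within (within e (R :|: S)) (~: X)) a v.
have [/existsP [v /and3P [vS vX av]]|h] := boolP [exists v,
  [&& v \in x |: S, v \notin X & connect (within (within e (R :|: S)) (~: X)) a v]].
  by exists a, v; split=> //; rewrite inE vX vS.
have : P b.
  apply: (@closed_connect _ _ P _ _ _ ab); last by rewrite /P aR connect0.
  move=> v w /andP [vR av] /and3P [vw]; rewrite !inE => vX wX.
  have vx : v != x.
    by apply: contraNneq h => vx; apply/existsP; exists v; rewrite av vX vx !inE eqxx.
  have wRS : w \in R :|: S.
    by apply: contraT => wRS; case/andP: (Rout v w vR wRS vw); rewrite (negPf vx).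
  have aw : connect (within (within e (R :|: S)) (~: X)) a w.
    by apply: connect_trans av _; apply: connect1; rewrite /within /= vw !inE vR vX wX -in_setU wRS.
  rewrite /P aw andbT; move: wRS; rewrite inE => /orP [//|wS].
  by case/negP: h; apply/existsP; exists w; rewrite aw wX !inE wS orbT.
by case/andP => /RSB /andP [_ /negPf bB']; move: bB; rewrite inE bB' andbF.
Qed.

(** Follow the path backwards from B: it stays off R until it meets y |: S, since R can be entered
    only through S or from y. *)
Lemma gap_linked2 (e : rel T) (A B S R X : {set T}) x y : symmetric e ->
  gap e A B S R x y -> linked e X A B ->
  linked (within e (~: R)) X (y |: S) B.
Proof.
move=> es [xy xR yRS RSB [AR Rout]] [a [b [aA bB ab]]].
have bX : b \notin X by move: bB; rewrite inE => /andP [].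
have bR : b \notin R.
  by apply/negP => /RSB /andP [_ /negPf bB']; move: bB; rewrite inE bB' andbF.
pose r := within (within e (~: R)) (~: X).
have rs : symmetric r by do 2 apply: within_sym.
pose P v := (v \notin R) && connect r b v.
have [/existsP [v /and3P [vS vX bv]]|h] := boolP [exists v,
  [&& v \in y |: S, v \notin X & connect r b v]].
  by exists v, b; split=> //; [rewrite inE vX vS | rewrite (sym_connect_sym rs)].
have ba : connect (within e (~: X)) b a by rewrite (sym_connect_sym (within_sym _ es)).
have /andP [aR raa]: P a.
  apply: (@closed_connect _ _ P _ _ _ ba); last by rewrite /P bR connect0.
  move=> v w /andP [vR bv] /and3P [vw]; rewrite !inE => vX wX.
  have vyS : v \notin y |: S.
    by apply: contraNN h => vS; apply/existsP; exists v; rewrite vS vX bv.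
  move: vyS; rewrite !inE negb_or => /andP [vy vS].
  have wR : w \notin R.
    apply/negP => wR; have /andP [_] : (w == x) && (v == y).
      by apply: Rout; rewrite ?inE ?negb_or ?vR // es.
    by rewrite (negPf vy).
  rewrite /P wR; apply: connect_trans bv _; apply: connect1.
  by rewrite /r /within /= vw !inE vR wR vX wX.
have [aX aA'] : a \notin X /\ a \in A by move: aA; rewrite inE => /andP [].
case/negP: h; apply/existsP; exists a; rewrite aX raa !inE.
have [aS|aS] := boolP (a \in S); first by rewrite orbT.
by case/negP: aR; apply: AR.
Qed.

(* Goring's proof: if deleting an edge leaves a separator S of size k - 1, then
   x |: S and y |: S both separate A from B, for an edge xy from the side R of A
   to the side of B; the systems from A to x |: S and from y |: S to B then meet
   only in S. *)
Theorem menger (e : rel T) (k : nat) (A B : {set T}) : symmetric e ->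
  (forall X : {set T}, #|X| < k -> linked e X A B) ->
  exists F : 'I_k -> {set T},
    [/\ forall i, conn e (F i), forall i j, i != j -> [disjoint F i & F j],
        forall i, exists2 a, a \in A & a \in F i &
        forall i, exists2 b, b \in B & b \in F i].
Proof.
move: {2}(nedges e).+1 (ltnSn (nedges e)) => m.
elim: m e k A B => // m IH e k A B; rewrite ltnS => em es hs.
have [/existsP [x /existsP [y /andP [xy nxy]]] | noe] :=
  boolP [exists x, exists y, e x y && (x != y)]; last first.
  apply: menger_edgeless => // a b ab; apply/eqP; apply: contraNT noe => nab.
  by apply/existsP; exists a; apply/existsP; exists b; rewrite ab.
pose e' := [rel a b | e a b && ~~ (((a == x) && (b == y)) || ((a == y) && (b == x)))].
have e's : symmetric e'.
  move=> a b /=; rewrite es; congr (_ && ~~ _).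
  by rewrite orbC [(b == y) && _]andbC [(b == x) && _]andbC.
have e'e a b : e' a b -> e a b by case/andP.
have lt_e' : nedges e' < nedges e.
  by apply: (nedges_lt e'e xy); rewrite /= xy !eqxx.
have [/existsP [S] | /existsPn hS] := boolP [exists S : {set T}, (#|S| < k) &&
   [forall a in A :\: S, forall b in B :\: S, ~~ connect (within e' (~: S)) a b]]; last first.
  have [||F [cF dF AF BF]] := IH e' k A B _ e's; first exact: leq_trans lt_e' em.
    move=> X Xk; move: (hS X); rewrite Xk /= => /forall_inPn [a aA /forall_inPn [b bB]].
    by rewrite negbK => ab; exists a, b.
  by exists F; split => // i; apply: conn_mono (cF i).
case/andP => Sk /forall_inP sepS.
have [||R [x' [y' G]]] := @gap_exists e e' A B S x y es _ (hs S Sk).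
- move=> a b ab; have [/orP [] /andP [/eqP -> /eqP->] | h] :=
    boolP (((a == x) && (b == y)) || ((a == y) && (b == x))); [by auto|by auto|].
  by left; rewrite /= ab.
- by case=> a [b [aA bB ab]]; have /forall_inP/(_ b bB) := sepS a aA; rewrite ab.
move: {x y xy nxy e' e's e'e lt_e' sepS} x' y' G => x y G.
have [xy xR yRS RSB [AR Rout]] := G.
have [yR yS] : y \notin R /\ y \notin S by move: yRS; rewrite inE negb_or => /andP.
have xS : x \notin S by case/andP: (RSB x xR).
have kP : #|x |: S| = k.
  apply/eqP; rewrite eqn_leq {1}cardsU1 xS Sk leqNgt; apply/negP => /hs.
  exact: gap_separator G.
have kQ : #|y |: S| = k by rewrite -kP !cardsU1 xS yS.
have [||F1 [cF1 dF1 AF1 PF1]] := IH (within e (R :|: S)) k A (x |: S) _ (within_sym _ es).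
- apply: leq_trans em; apply: (nedges_lt _ xy); first by move=> a b /and3P [].
  by apply: contraNN yRS => /and3P [].
- by move=> X /hs; apply: (gap_linked1 G).
have [||F2 [cF2 dF2 QF2 BF2]] := IH (within e (~: R)) k (y |: S) B _ (within_sym _ es).
- apply: leq_trans em; apply: (nedges_lt _ xy); first by move=> a b /and3P [].
  by rewrite /within /= !inE xR andbF.
- by move=> X /hs; apply: (gap_linked2 es G).
have [|g1 g1i [F1P P1]] := disjoint_hit dF1 PF1; first by rewrite card_ord kP.
have [|g2 g2i [F2Q Q2]] := disjoint_hit dF2 QF2; first by rewrite card_ord kQ.
(* [p] replaces x by y and fixes S; it matches the ends of the first system with the starts of the
   second. *)
pose p i := if g1 i == x then y else g1 i.
have g1P i : g1 i \in x |: S.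
  by have /setP/(_ (g1 i)) := F1P i; rewrite in_set1 eqxx inE => /andP [].
have pQ i : p i \in y |: S.
  by rewrite /p; move: (g1P i); rewrite !inE; case: eqP => /= _; rewrite ?eqxx // => ->;
    rewrite orbT.
have [j jP] := fin_all_exists (fun i => Q2 _ (pQ i)).
have pi : injective p.
  have xyS i : g1 i <> y.
    move=> gy; move: (g1P i); rewrite gy !inE (negPf yS) orbF => /eqP yx.
    by rewrite yx xR in yR.
  move=> i i'; rewrite /p; have [E|_] := eqVneq (g1 i) x; have [E'|_] := eqVneq (g1 i') x.
  - by move=> _; apply: g1i; rewrite E E'.
  - by move/esym/xyS.
  - by move/xyS.
  - exact: g1i.
have ji : injective j by move=> i i' h; apply: pi; rewrite !jP h.
have F1R i a : a \in F1 i -> a \in R :|: S.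
  suff : F1 i \subset R :|: S by move/subsetP; apply.
  have /setP/(_ (g1 i)) := F1P i; rewrite in_set1 eqxx inE => /andP [gF _].
  apply: (conn_support _ (cF1 i) gF) => [c d /and3P [_ -> ->] //|].
  by move: (g1P i); rewrite !inE => /orP [/eqP->|->]; rewrite ?xR ?orbT.
have F2R i a : a \in F2 i -> a \notin R.
  suff : F2 i \subset ~: R by move/subsetP => h /h; rewrite inE.
  have /setP/(_ (g2 i)) := F2Q i; rewrite in_set1 eqxx inE => /andP [gF gQ].
  apply: (conn_support _ (cF2 i) gF) => [c d /and3P [_ -> ->] //|].
  move: gQ; rewrite !inE => /orP [/eqP-> //|]; apply: contraL => /RSB.
  by case/andP.
(* A common vertex lies in S. It is then the only point of x |: S on the first set and of y |: S on
   the second, so the two sets were matched. *)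
have F12 i i' a : a \in F1 i -> a \in F2 (j i') -> i = i'.
  move=> a1 a2; have aS : a \in S by move: (F1R _ _ a1) (F2R _ _ a2); rewrite inE => /orP [->|].
  have /setP/(_ a) := F1P i; rewrite !inE a1 aS orbT /= => /esym/eqP ag1.
  have /setP/(_ a) := F2Q (j i'); rewrite !inE a2 aS orbT /= => /esym/eqP ag2.
  apply: pi; rewrite [RHS]jP -ag2 /p -ag1.
  by case: eqP => // ax; rewrite ax (negPf xS) in aS.
exists (fun i => F1 i :|: F2 (j i)); split.
- move=> i; apply: (@connU _ _ _ _ (g1 i) (g2 (j i))) => //.
  + by apply: conn_mono (cF1 i) => a b /and3P [].
  + by apply: conn_mono (cF2 (j i)) => a b /and3P [].
  + by have /setP/(_ (g1 i)) := F1P i; rewrite in_set1 eqxx inE => /andP [].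
  + by have /setP/(_ (g2 (j i))) := F2Q (j i); rewrite in_set1 eqxx inE => /andP [].
  + by rewrite -jP /p; have [->|_] := eqVneq (g1 i) x; rewrite ?xy ?eqxx ?orbT.
- move=> i i' ii'; apply/pred0P => a /=; apply: contraNF ii' => /andP [].
  rewrite !inE => /orP [a1|a2] /orP [b1|b2].
  + by apply: contraLR b1 => /dF1 /pred0P/(_ a) /=; rewrite a1 => /= ->.
  + by apply/eqP; apply: F12 b2.
  + by apply/eqP/esym; apply: F12 a2.
  + rewrite -(inj_eq ji); apply: contraLR b2 => /dF2 /pred0P/(_ a) /=.
    by rewrite a2 => /= ->.
- by move=> i; have [a aA aF] := AF1 i; exists a; rewrite // inE aF.
- by move=> i; have [b bB bF] := BF2 (j i); exists b; rewrite // inE bF orbT.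
Qed.
End Menger.

(** With exactly |K| starting points, each set contains one of them, so the system can be indexed by
    its terminals. *)
Lemma menger_terminals (T K : finType) (z : K -> T) (e : rel T) (B : {set T}) :
  injective z -> symmetric e ->
  (forall X : {set T}, #|X| < #|K| -> linked e X (z @: K) B) ->
  exists F : K -> {set T},
    [/\ forall k, conn e (F k), forall k l, k != l -> [disjoint F k & F l],
        forall k, z k \in F k & forall k, exists2 b, b \in B & b \in F k].
Proof.
move=> zi es h; have [F [cF dF AF BF]] := menger es h.
have [|g gi [gF gs]] := disjoint_hit dF AF; first by rewrite card_ord leq_imset_card.
have [i iP] := fin_all_exists (fun k => gs (z k) (imset_f z (erefl : k \in K))).
have ii : injective i by move=> k l kl; apply: zi; rewrite !iP kl.
exists (fun k => F (i k)); split=> //.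
  by move=> k l kl; apply: dF; rewrite (inj_eq ii).
by move=> k; have /setP/(_ (z k)) := gF (i k); rewrite in_set1 iP eqxx inE => /andP [].
Qed.

(** * Contraction of an edge *)

Section Contraction.
Variables (T : finType) (e : rel T) (x y : T).
Hypothesis es : symmetric e.
Hypothesis xy : e x y.

(** The contracted graph keeps the vertex type: x inherits the neighbours of y, and y becomes
    isolated and is dropped from the current vertex set. Sets and terminals need no transport along
    a quotient. *)
Definition contract : rel T := [rel a b |
  [&& a != y, b != y, a != b & [|| e a b, (a == x) && e y b | (b == x) && e a y]]].

Definition uncontract (C : {set T}) : {set T} := if x \in C then y |: C else C.

Lemma contract_sym : symmetric contract.
Proof.
move=> a b; rewrite /contract /= [b == a]eq_sym [e b a]es [e y a]es [e b y]es.
by case: (a == y); case: (b == y); rewrite //= [X in _ || X]orbC.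
Qed.

Lemma sub_uncontract (C : {set T}) : C \subset uncontract C.
Proof. by rewrite /uncontract; case: ifP => // _; apply: subsetUr. Qed.

Lemma in_uncontract (C : {set T}) a : (a \in uncontract C) = (a \in C) || (a == y) && (x \in C).
Proof. by rewrite /uncontract; case: ifP => _; rewrite ?inE ?andbT ?andbF ?orbF // orbC. Qed.

Lemma conn_uncontract (C : {set T}) : conn contract C -> conn e (uncontract C).
Proof.
move=> cC; set C' := uncontract C.
have sC a : a \in C -> a \in C' by apply/subsetP/sub_uncontract.
have C'C a b : a \in C -> b \in C -> connect (within e C') a b.
  move=> aC bC; apply: (@connect_homo _ _ _ _ id) (cC a b aC bC) => {aC bC}c d.
  case/and3P => /and4P [_ _ _ cd] cC' dC'; have [c' d'] := (sC _ cC', sC _ dC').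
  case/or3P: cd => [cd | /andP [/eqP cx yd] | /andP [/eqP dx cy]].
  - by apply: connect1; rewrite /within /= cd c'.
  - have y' : y \in C' by rewrite in_uncontract eqxx -cx cC' orbT.
    apply: (@connect_trans _ _ y); apply: connect1; rewrite /within /= y'.
      by rewrite c' cx xy.
    by rewrite yd d'.
  - have y' : y \in C' by rewrite in_uncontract eqxx -dx dC' orbT.
    apply: (@connect_trans _ _ y); apply: connect1; rewrite /within /= y'.
      by rewrite c' cy.
    by rewrite d' dx es xy.
have csym := sym_connect_sym (within_sym C' es).
have yC a : a \in C' -> exists2 b, b \in C & connect (within e C') a b.
  move=> aC'; move: (aC'); rewrite in_uncontract.
  case/orP => [aC|/andP [/eqP ay xC]]; first by exists a; rewrite ?connect0.
  by exists x => //; apply: connect1; rewrite /within /= (sC _ xC) aC' ay es xy.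
move=> a b /yC [a' a'C aa'] /yC [b' b'C bb']; apply: connect_trans aa' _.
by rewrite csym; apply: connect_trans bb' _; apply: C'C.
Qed.

Lemma disjoint_uncontract (C D : {set T}) : y \notin C -> y \notin D ->
  [disjoint C & D] -> [disjoint uncontract C & uncontract D].
Proof.
move=> yC yD /pred0P CD; apply/pred0P => a /=; apply/negP; rewrite !in_uncontract.
case/andP => /orP [aC|/andP [/eqP ay xC]] /orP [aD|/andP [/eqP ay' xD]].
- by have := CD a; rewrite /= aC aD.
- by rewrite ay' (negPf yC) in aC.
- by rewrite ay (negPf yD) in aD.
- by have := CD x; rewrite /= xC xD.
Qed.

Definition merge (a : T) : T := if a == y then x else a.

Lemma in_uncontract_merge (C : {set T}) a :
  y \notin C -> (a \in uncontract C) = (merge a \in C).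
Proof.
rewrite in_uncontract /merge; case: (eqVneq a y) => [-> /negPf -> //|_ _].
by rewrite orbF.
Qed.

Lemma contract_edge a b : x != y -> e a b -> merge a != merge b ->
  contract (merge a) (merge b).
Proof.
move=> nxy ab nab; have fy c : merge c != y by rewrite /merge; case: (eqVneq c y).
apply/and4P; split; try by [apply: fy | apply: nab].
move: nab; rewrite /merge; case: (eqVneq a y) => [ay|_]; case: (eqVneq b y) => [bY|_].
- by rewrite eqxx.
- by rewrite -ay ab eqxx orbT.
- by rewrite -bY ab eqxx !orbT.
- by rewrite ab.
Qed.

Lemma connect_contract (A : {set T}) a b : x != y -> (y \in A -> x \in A) ->
  connect (within e A) a b -> connect (within contract (A :\ y)) (merge a) (merge b).
Proof.
move=> nxy yxA; apply: connect_homo => {a b} a b /and3P [ab aA bA].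
have [-> | nab] := eqVneq (merge a) (merge b); first exact: connect0.
have fA c : c \in A -> merge c \in A :\ y.
  by move=> cA; rewrite /merge !inE; case: (eqVneq c y) => [cy|->//]; rewrite nxy yxA // -cy.
by apply: connect1; apply/and3P; split; [apply: contract_edge | apply: fA..].
Qed.

Lemma conn_contract (A : {set T}) : x != y -> (y \in A -> x \in A) ->
  conn e A -> conn contract (A :\ y).
Proof.
move=> nxy yxA cA a b /setD1P [ay aA] /setD1P [bY bA].
by have := connect_contract nxy yxA (cA a b aA bA); rewrite /merge (negPf ay) (negPf bY).
Qed.

Definition touch (r : rel T) (X Y : {set T}) : Prop :=
  exists a b : T, [/\ a \in X, b \in Y & r a b].

Lemma touch_contract (A B : {set T}) : x != y -> (y \in A -> x \in A) ->
  (y \in B -> x \in B) -> [disjoint A & B] ->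
  touch e A B -> touch contract (A :\ y) (B :\ y).
Proof.
move=> nxy yA yB /pred0P dAB [a [b [aA bB ab]]].
have nAB u v : u \in A -> v \in B -> u != v.
  by move=> uA vB; apply/eqP => uv; have := dAB u; rewrite /= uA uv vB.
have [ay|ay] := eqVneq a y; have [bY|bY] := eqVneq b y.
- by have := nAB _ _ aA bB; rewrite ay bY eqxx.
- have xA : x \in A by apply: yA; rewrite -ay.
  by exists x, b; rewrite !inE xA bB bY nxy /contract /= nxy bY nAB // -ay eqxx ab orbT.
- have xB : x \in B by apply: yB; rewrite -bY.
  by exists a, x; rewrite !inE xB aA ay nxy /contract /= nxy ay nAB // -bY eqxx ab !orbT.
- by exists a, b; rewrite !inE aA bB ay bY /contract /= ay bY nAB // ab.
Qed.

Lemma touch_uncontract (C D : {set T}) :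
  touch contract C D -> touch e (uncontract C) (uncontract D).
Proof.
move=> [a [b [aC bD /and4P [_ _ _]]]]; case/or3P => [ab | /andP [/eqP ax yb] | /andP [/eqP bx ay]].
- by exists a, b; rewrite !in_uncontract aC bD.
- by exists y, b; rewrite !in_uncontract eqxx -ax aC bD orbT.
- by exists a, y; rewrite !in_uncontract eqxx -bx aC bD orbT.
Qed.

End Contraction.

(** * Linking through a clique minor *)

Definition separation (T : finType) (e : rel T) (V X Y : {set T}) : Prop :=
  X :|: Y = V /\ (forall a b, a \in X :\: Y -> b \in Y :\: X -> ~~ e a b).

(** [Q k] and [Q (s k)] serve the same pair of terminals, so only sets of different pairs have to be
    disjoint. *)
Definition linkage (T K : finType) (e : rel T) (V : {set T}) (z : K -> T) (s : K -> K) :=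
  exists Q : K -> {set T},
    [/\ forall k, conn e (Q k), forall k, Q k \subset V,
        forall k, (z k \in Q k) && (z (s k) \in Q k) &
        forall k l, l != k -> l != s k -> [disjoint Q k & Q l]].

(* The generalised clique minor of Robertson and Seymour (Graph Minors XIII): a branch set
   may be disconnected, and two branch sets need not touch, as long as the pieces are
   anchored at terminals.  This is what survives on one side of a separation. *)
Record hub (T K I : finType) (e : rel T) (V : {set T}) (z : K -> T)
    (A : I -> {set T}) : Prop := Hub {
  hub_inj : injective z;
  hub_z : forall k, z k \in V;
  hub_sub : forall i, A i \subset V;
  hub_ne : forall i, exists a, a \in A i;
  hub_disj : forall i j, i != j -> [disjoint A i & A j];
  hub_comp : forall i, conn e (A i) \/
    (forall a, a \in A i -> exists2 k, z k \in A i & connect (within e (A i)) a (z k));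
  hub_touch : forall i j, i != j -> touch e (A i) (A j) \/
    ((exists k, z k \in A i) /\ (exists k, z k \in A j));
  hub_sep : forall X Y i, separation e V X Y -> (forall k, z k \in X) ->
    #|X :&: Y| < #|K| -> exists2 a, a \in X & a \in A i
}.

(** * Contractions and separations of a hub *)

Section Hub.
Variables T K I : finType.
Implicit Types (e : rel T) (V X Y : {set T}) (z : K -> T) (A : I -> {set T}).

Lemma disjoint_in (A B : {set T}) a : [disjoint A & B] -> a \in A -> a \in B -> False.
Proof. by move/pred0P/(_ a) => /= + aA aB; rewrite aA aB. Qed.

Lemma linkage_contract e x y V z s : symmetric e -> e x y -> y \in V -> x \in V -> x != y ->
  linkage (contract e x y) (V :\ y) z s -> linkage e V z s.
Proof.
move=> es xy yV xV nxy [Q [cQ QV zQ dQ]].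
have yQ k : y \notin Q k.
  by apply/negP => /(subsetP (QV k)); rewrite !inE eqxx.
exists (fun k => uncontract x y (Q k)); split.
- by move=> k; apply: conn_uncontract.
- move=> k; apply/subsetP => a; rewrite in_uncontract => /orP [|/andP [/eqP->//]].
  by move/(subsetP (QV k)); rewrite inE => /andP [].
- by move=> k; have /andP [a b] := zQ k; rewrite !in_uncontract a b.
- by move=> k l lk lsk; apply: disjoint_uncontract => //; apply: dQ.
Qed.

Lemma separation_contract e x y V X Y : symmetric e -> e x y -> x \in V -> x != y ->
  y \in V -> separation (contract e x y) (V :\ y) X Y ->
  [/\ y \notin X, y \notin Y & separation e V (uncontract x y X) (uncontract x y Y)].
Proof.
move=> es xy xV nxy yV [XY nXY].
have [yX yY] : y \notin X /\ y \notin Y.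
  by apply/andP; rewrite -negb_or -in_setU XY !inE eqxx.
split=> //; split.
  apply/setP => a; rewrite inE !in_uncontract_merge // -in_setU XY !inE /merge.
  by case: (eqVneq a y) => [->|/negPf->//]; rewrite nxy xV yV.
move=> a b; rewrite !inE !in_uncontract_merge // => /andP [aY aX] /andP [bX bY].
apply/negP => ab; have nab : merge x y a != merge x y b by apply: contraNneq bX => <-.
have := nXY (merge x y a) (merge x y b); rewrite !inE aX aY bX bY => /(_ isT isT) /negP.
by apply; apply: contract_edge.
Qed.

Lemma hub_contract e x y V z A i : symmetric e -> e x y -> x != y ->
  x \in A i -> y \in A i -> (forall k, z k != y) -> hub e V z A ->
  (forall X Y j, separation e V X Y -> (forall k, z k \in X) ->
     x \in X :&: Y -> y \in X :&: Y ->
     [disjoint X & A j] -> #|X :&: Y| <= #|K| -> False) ->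
  hub (contract e x y) (V :\ y) z (fun j => A j :\ y).
Proof.
move=> es xy nxy xA yA zy [zi zV AV An Ad Ac At As] sep.
have xV := subsetP (AV i) _ xA; have yV := subsetP (AV i) _ yA.
have yAx j : y \in A j -> x \in A j.
  have [<-//|ij] := eqVneq i j; first by move=> yAj; case: (disjoint_in (Ad _ _ ij) yA yAj).
split=> //.
- by move=> k; rewrite !inE zy zV.
- by move=> j; apply: setSD.
- move=> j; have [a aA] := An j; exists (merge x y a); rewrite !inE /merge.
  by case: (eqVneq a y) => [ay|->//]; rewrite nxy yAx // -ay.
- move=> j l /Ad jl; apply: disjointWl (subsetDl _ _) _.
  by apply: disjointWr (subsetDl _ _) jl.
- move=> j; have [cA|h] := Ac j; first by left; apply: conn_contract (yAx j) cA.
  right=> a /setD1P [ay aA]; have [k kA ak] := h a aA.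
  exists k; rewrite ?inE ?zy // in kA *.
  by have := connect_contract nxy (yAx j) ak; rewrite /merge (negPf ay) (negPf (zy k)).
- move=> j l jl; have [t|[[k kA] [k' kA']]] := At j l jl.
    by left; apply: touch_contract => //; [apply: yAx.. | apply: Ad].
  by right; split; [exists k | exists k']; rewrite !inE zy.
- move=> X Y j sXY zX cXY; apply/exists_inP; apply: contraT => /exists_inPn nXA.
  have [yX yY sXY'] := separation_contract es xy xV nxy yV sXY.
  have XY' : uncontract x y X :&: uncontract x y Y \subset y |: (X :&: Y).
    apply/subsetP => a; rewrite !inE !in_uncontract.
    by case/andP => /orP [->|/andP [-> //]] /orP [->|/andP [-> //]]; rewrite orbT.
  have dX : [disjoint uncontract x y X & A j].
    apply/pred0P => a /=; apply/negP; rewrite in_uncontract => /andP [/orP [aX|]] aA.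
      by have := nXA a aX; rewrite !inE aA andbT negbK => /eqP ay; rewrite ay (negPf yX) in aX.
    move: aA => /andP [/eqP-> xX] yA'; have := nXA x xX.
    by rewrite !inE nxy (yAx j).
  have zX' k : z k \in uncontract x y X by rewrite in_uncontract zX.
  have [lt|le] := ltnP #|uncontract x y X :&: uncontract x y Y| #|K|.
    by have [a aX aA] := As _ _ j sXY' zX' lt; case: (disjoint_in dX aX aA).
  have yXY : y \in uncontract x y X :&: uncontract x y Y.
    apply: contraLR (leq_trans cXY le) => nyXY; rewrite -leqNgt subset_leq_card //.
    apply/subsetP => a aXY; move: (subsetP XY' a aXY).
    by rewrite in_setU1; case: eqP => // ay; rewrite ay (negPf nyXY) in aXY.
  have xXY : x \in uncontract x y X :&: uncontract x y Y.
    move: yXY; rewrite !inE !in_uncontract_merge // /merge eqxx => /andP [xX xY].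
    by rewrite (negPf nxy) xX xY.
  exfalso; apply: (sep _ _ j sXY' zX' xXY yXY dX).
  apply: leq_trans (subset_leq_card XY') _; apply: leq_trans cXY.
  by rewrite cardsU1; case: (y \notin _).
Qed.

(** Fewer than |K| vertices cannot cut the terminals from X :&: Y within X, as they would also cut
    them from [A i0]. So disjoint sets [F k] lead from the terminals onto all of X :&: Y. The points
    reached are the terminals of a hub on Y, and a linkage there is extended back along F. *)
Lemma linkage_sep e V z A (s : K -> K) X Y i0 : symmetric e -> involutive s ->
  hub e V z A -> 1 < #|I| ->
  separation e V X Y -> (forall k, z k \in X) -> [disjoint X & A i0] -> #|X :&: Y| = #|K| ->
  (forall z', hub e Y z' (fun i => A i :&: Y) -> linkage e Y z' s) ->
  linkage e V z s.
Proof.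
move=> es ss [zi zV AV An Ad Ac At As] I2 [XYV nXY] zX dX cXY IH.
have inXY a : a \in V -> (a \in X) || (a \in Y) by rewrite -XYV inE.
have subX : X \subset V by rewrite -XYV subsetUl.
have subY : Y \subset V by rewrite -XYV subsetUr.
have exY a b : a \in Y -> a \notin X -> b \in V -> e a b -> b \in Y.
  move=> aY aX bV ab; apply: contraT => bY; have bX := inXY b bV; rewrite (negPf bY) orbF in bX.
  by have := nXY b a; rewrite !inE aY aX bY bX es ab => /(_ isT isT).
have [|F [cF dF zF YF]] := @menger_terminals T K z (within e X) (X :&: Y) zi (within_sym _ es).
  move=> C Ck.
  pose r := within (within e X) (~: C).
  pose R := [set v | [exists k, (z k \notin C) && connect r (z k) v]].
  have RX v : v \in R -> (v \in X) && (v \notin C).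
    rewrite inE => /existsP [k /andP [kC kv]]; rewrite andbC -in_setD.
    apply: (closed_connect_in _ kv) => [a b _ /and3P [/and3P [_ _ bX] _ bC]|].
      by rewrite in_setD bX andbT -in_setC.
    by rewrite in_setD kC zX.
  have [/existsP [v /andP [vR vY]]|h] := boolP [exists v, (v \in R) && (v \in Y)].
    have /andP [vX vC] := RX v vR; move: vR; rewrite inE => /existsP [k /andP [kC kv]].
    by exists (z k), v; rewrite !inE kC vC vX vY imset_f.
  have RY v : v \in R -> v \notin Y.
    by move=> vR; apply: contra h => vY; apply/existsP; exists v; rewrite vR.
  have RC v : v \in R -> v \notin (X :\: R) :|: Y.
    by move=> vR; rewrite !in_setU in_setD vR (negPf (RY v vR)).
  (* If the part R of X reached from the terminals off C misses Y, then R and C make one side of a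
     separation of order at most |C| whose first side misses [A i0]. *)
  have sep' : separation e V (R :|: (C :&: X)) ((X :\: R) :|: Y).
    split.
      apply/setP => a; rewrite -XYV !in_setU in_setD in_setI.
      have := RX a; case: (a \in R) => /= [/(_ isT)/andP [-> _] //|_].
      by case: (a \in X); rewrite ?orbT ?andbF.
    move=> a b /setDP [aS aS'] /setDP [bS' bS]; apply/negP => ab.
    have aR : a \in R.
      move: aS aS'; rewrite !in_setU in_setD in_setI.
      by case: (a \in R) => //= /andP [_ ->].
    have /andP [aX aC] := RX a aR.
    move: bS; rewrite in_setU in_setI negb_or => /andP [bR bCX].
    have bX : b \in X.
      move: bS'; rewrite in_setU in_setD => /orP [/andP []//|bY].
      apply: contraT => bX; have := nXY a b.
      by rewrite !inE aX bY bX (RY a aR) ab => /(_ isT isT).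
    case/negP: bR; move: aR; rewrite !in_set => /existsP [k /andP [kC ka]].
    apply/existsP; exists k; rewrite kC; apply: connect_trans ka _; apply: connect1.
    by apply/and3P; rewrite !inE aC; split=> //; [apply/and3P | by move: bCX; rewrite bX andbT].
  have [k||a] := As _ _ i0 sep'.
  - rewrite in_setU in_setI zX andbT orbC; case kC: (z k \in C) => //=.
    by rewrite in_set; apply/existsP; exists k; rewrite kC connect0.
  - apply: leq_ltn_trans Ck; apply: subset_leq_card; apply/subsetP => a.
    by rewrite in_setI in_setU in_setI => /andP [/orP [/RC/negPf->|/andP []]].
  - rewrite in_setU in_setI => /orP [/RX/andP [aX _]|/andP [_ aX]] aA.
      by case: (disjoint_in dX aX aA).
    by case: (disjoint_in dX aX aA).
have FX k : F k \subset X.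
  by apply: (conn_support _ (cF k) (zF k)) => [a b /and3P [_ -> ->]|].
have [|z' z'i [Fz' sz']] := disjoint_hit dF YF; first by rewrite cXY.
have z'XY k : (z' k \in F k) && (z' k \in X :&: Y).
  by have /setP/(_ (z' k)) := Fz' k; rewrite in_set1 eqxx in_setI.
have z'X a : a \in X :&: Y -> exists k, z' k = a by move/sz' => [k ->]; exists k.
(* A piece of [A i] cut off by the restriction to Y was joined to X inside [A i], so it contains a
   vertex of X :&: Y, and each such vertex is a new terminal. This anchors the pieces as a hub
   demands. *)
have comp i a b : a \in A i -> a \in Y -> b \in A i -> b \in X ->
    exists2 k, z' k \in A i :&: Y & connect (within e (A i :&: Y)) a (z' k).
  move=> aA aY bA bX.
  have [c cX ac] : exists2 c, c \in X & connect (within e (A i)) a c.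
    have [cA|h] := Ac i; first by exists b; rewrite // cA.
    by have [k kA ak] := h a aA; exists (z k).
  pose R := [set v | connect (within e (A i :&: Y)) a v].
  have [/existsP [v /andP [av vX]]|h] :=
    boolP [exists v, connect (within e (A i :&: Y)) a v && (v \in X)].
    have : v \in A i :&: Y by apply: connect_within av _; rewrite in_setI aA.
    move=> vAY; have [|k kv] := z'X v.
      by move: vAY; rewrite !in_setI vX => /andP [].
    by exists k; rewrite kv.
  have Rh v : connect (within e (A i :&: Y)) a v -> v \notin X.
    by move=> av; apply: contra h => vX; apply/existsP; exists v; rewrite av.
  suff : connect (within e (A i :&: Y)) a c by move/Rh; rewrite cX.
  apply: (closed_connect _ ac); last exact: connect0.
  move=> u v au /and3P [uv uA vA]; apply: (connect_trans au); apply: connect1.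
  have uAY : u \in A i :&: Y by apply: (connect_within au); rewrite in_setI aA.
  have uY : u \in Y by move: uAY; rewrite in_setI => /andP [].
  apply/and3P; split=> //; rewrite in_setI vA /=.
  by apply: (exY u) uv => //; [apply: Rh | apply: (subsetP (AV i))].
have nAX i a : a \in A i -> a \in X -> i != i0.
  by move=> aA aX; apply/eqP => ii; apply: (disjoint_in dX aX); rewrite -ii.
have i0Y a : a \in A i0 -> (a \in Y) && (a \notin X).
  move=> aA; have aX : a \notin X by apply/negP => aX; apply: (disjoint_in dX aX aA).
  by have := inXY a (subsetP (AV i0) _ aA); rewrite (negPf aX) /= => ->.
have AY i : exists a, a \in A i :&: Y.
  have [->|ii] := eqVneq i i0.
    by have [a aA] := An i0; exists a; rewrite in_setI aA; case/andP: (i0Y a aA).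
  have [[a [b [aA bA ab]]]|[_ [k zA]]] := At i i0 ii.
    exists a; rewrite in_setI aA /=; have /andP [bY bX] := i0Y b bA.
    by apply: (exY b); rewrite // 1?es // (subsetP (AV i)).
  by have /andP [_] := i0Y _ zA; rewrite zX.
have comp' i : (forall a, a \in A i -> a \in X -> False) \/
    (forall a, a \in A i :&: Y ->
      exists2 k, z' k \in A i :&: Y & connect (within e (A i :&: Y)) a (z' k)).
  have [/existsP [b /andP [bA bX]]|h] := boolP [exists b, (b \in A i) && (b \in X)].
    by right=> a; rewrite in_setI => /andP [aA aY]; apply: (comp i a b).
  by left=> a aA aX; case/negP: h; apply/existsP; exists a; rewrite aA.
have [Q [cQ QY zQ dQ]] : linkage e Y z' s.
  apply: IH; split.
  - by [].
  - by move=> k; have /andP [_] := z'XY k; rewrite in_setI => /andP [].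
  - by move=> i; apply: subsetIr.
  - exact: AY.
  - by move=> i j /Ad ij; apply: disjointWl (subsetIl _ _) _; apply: disjointWr (subsetIl _ _) ij.
  - move=> i; case: (comp' i) => [nX|]; last by right.
    left; have -> : A i :&: Y = A i.
      apply/setIidPl/subsetP => a aA; have := inXY a (subsetP (AV i) _ aA).
      by case/orP => // /(nX a aA).
    case: (Ac i) => // h; have [a /h [k /nX]] := An i.
    by case/(_ (zX k)).
  - move=> i j ij.
    have sideA i' j' : i' != j' -> (forall a, a \in A i' -> a \in X -> False) ->
       touch e (A i' :&: Y) (A j' :&: Y).
      move=> ij' nX; have [[a [b [aA bA ab]]]|[[k zA] _]] := At i' j' ij'; last by case: (nX _ zA).
      have aX : a \notin X by apply/negP => /(nX a aA).
      have aY : a \in Y by have := inXY a (subsetP (AV i') _ aA); rewrite (negPf aX).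
      exists a, b; rewrite !in_setI aA bA aY; split=> //=.
      by apply: (exY a); rewrite // (subsetP (AV j')).
    case: (comp' i) => [/(sideA i j ij)|hi]; first by left.
    case: (comp' j) => [/(sideA j i)|hj].
      rewrite eq_sym => /(_ ij) [a [b [aA bA ab]]]; left; exists b, a.
      by rewrite es.
    right; have [a /hi [k zk _]] := AY i; have [b /hj [k' zk' _]] := AY j.
    by split; [exists k | exists k'].
  - move=> X' Y' i [XY' nXY'] zX' cX'.
    have inX' a : a \in X -> a \in Y -> a \in X'.
      by move=> aX aY; have [|k <-] := z'X a; rewrite ?in_setI ?aX.
    have inY' a : a \in Y' -> a \in Y by rewrite -XY' inE => ->; rewrite orbT.
    have sX' a : a \in X' -> a \in Y by rewrite -XY' inE => ->.
    (* X' contains X :&: Y, because every vertex of it is a new terminal; so enlarging X' by X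
       leaves the middle unchanged. *)
    have sep' : separation e V (X :|: X') Y'.
      split; first by rewrite -setUA XY' XYV.
      move=> a b /setDP [aX aY'] /setDP [bY' bX]; apply/negP => ab.
      move: bX; rewrite in_setU negb_or => /andP [bX bX'].
      have [aX'|aX'] := boolP (a \in X').
        by have := nXY' a b; rewrite !inE aX' aY' bX' bY' ab => /(_ isT isT).
      have {}aX : a \in X by move: aX; rewrite in_setU (negPf aX') orbF.
      have aY : a \notin Y by apply: contra aX'; apply: inX'.
      by have := nXY a b; rewrite !inE aX aY bX inY' // ab => /(_ isT isT).
    have [k||a] := As _ _ i sep'.
    + by rewrite in_setU zX.
    + apply: leq_ltn_trans cX'; apply: subset_leq_card; apply/subsetP => a.
      rewrite !inE => /andP [/orP [aX|->] aY'] //; rewrite aY' andbT.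
      by apply: inX' => //; apply: inY'.
    rewrite in_setU => /orP [aX|aX'] aA; last first.
      by exists a; rewrite // in_setI aA sX'.
    case: (comp' i) => [/(_ a aA aX)//|h]; have [b /h [k zk _]] := AY i.
    by exists (z' k).
have FQ k l v : v \in F k -> v \in Q l -> k != l -> k != s l -> False.
  move=> vF vQ kl ksl; have vXY : v \in F k :&: (X :&: Y).
    by rewrite !in_setI vF (subsetP (FX k) _ vF) (subsetP (QY l) _ vQ).
  move: vXY; rewrite Fz' => /set1P vz; have /andP [zQk _] := zQ k.
  by apply: (disjoint_in (dQ l k kl ksl) vQ); rewrite vz.
have cF' k : conn e (F k) by apply: conn_mono (cF k) => a b /and3P [].
have z'F k : z' k \in F k by case/andP: (z'XY k).
exists (fun k => F k :|: Q k :|: F (s k)); split.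
- move=> k; have /andP [zQ1 zQ2] := zQ k; apply: (@connU _ _ _ _ (z' (s k)) (z' (s k))) => //.
  + by apply: (@connU _ _ _ _ (z' k) (z' k)); rewrite ?eqxx.
  + by rewrite in_setU zQ2 orbT.
  + by rewrite eqxx.
- move=> k; rewrite !subUset (subset_trans (QY k) subY) !andbT.
  by apply/andP; split; apply: subset_trans (FX _) subX.
- by move=> k; rewrite !in_setU !zF !orbT.
- move=> k l lk lsk; apply/pred0P => v /=; apply/negP => /andP [].
  have slk : s l != k by apply: contraNneq lsk => <-; rewrite ss.
  have slsk : s l != s k by rewrite (inj_eq (inv_inj ss)).
  rewrite !in_setU => /orP [/orP [v1|v1]|v1] /orP [/orP [v2|v2]|v2].
  + by apply: (disjoint_in (dF l k lk)) v2 v1.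
  + by apply: (FQ k l v) => //; rewrite eq_sym.
  + by apply: (disjoint_in (dF _ _ slk)) v2 v1.
  + by apply: (FQ l k v).
  + by apply: (disjoint_in (dQ _ _ lk lsk)) v1 v2.
  + by apply: (FQ (s l) k v).
  + by apply: (disjoint_in (dF _ _ lsk)) v2 v1.
  + by apply: (FQ (s k) l v); rewrite // eq_sym // (inj_eq (inv_inj ss)) eq_sym.
  + by apply: (disjoint_in (dF _ _ slsk)) v2 v1.
Qed.
End Hub.

Section HubLinkage.
Variables T K I : finType.
Implicit Types (e : rel T) (V X Y : {set T}) (z : K -> T) (A : I -> {set T}).

(** A branch set without terminals is connected, by [hub_comp], and has no inner edge, so it is a
    single vertex; any two of these touch. At most |K| of the disjoint branch sets contain a
    terminal. *)
Lemma hub_clique e V z A : symmetric e -> hub e V z A ->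
  (forall i x y, x \in A i -> y \in A i -> e x y -> x != y -> exists k, z k = y) ->
  exists2 J : {set I}, #|I| <= #|J| + #|K| &
  exists q : I -> T, (forall i, q i \in A i) /\
    {in J, forall i, A i = [set q i]} /\
    {in J &, forall i j, i != j -> e (q i) (q j)}.
Proof.
move=> es [zi zV AV An Ad Ac At As] noe.
pose J := [set i | [forall k, z k \notin A i]]; exists J.
  rewrite -[#|I|]cardsT -(cardsID J) setTI leq_add2l setTD.
  have [g gP] : exists g : I -> T, forall i, i \in ~: J -> (g i \in A i) && (g i \in z @: K).
    apply: (@fin_all_exists _ _ (fun i t => i \in ~: J -> (t \in A i) && (t \in z @: K))) => i.
    have [iJ|] := boolP (i \in J); first by have [a _] := An i; exists a; rewrite inE iJ.
    rewrite inE => /forallPn [k]; rewrite negbK => zA; exists (z k) => _.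
    by rewrite zA imset_f.
  rewrite -(card_imset K zi) -(@card_in_imset _ _ g (mem (~: J))).
    apply: subset_leq_card; apply/subsetP => _ /imsetP [i iJ ->].
    by case/andP: (gP i iJ).
  move=> i j /gP/andP [gi _] /gP/andP [gj _] gij; apply/eqP; apply: contraT => /Ad ij.
  by case: (disjoint_in ij gi); rewrite gij.
have [q qP] := fin_all_exists An; exists q; split=> //.
have single l a : l \in J -> a \in A l -> a = q l.
  rewrite inE => /forallP zA aA; apply/eqP; case: (Ac l) => [cA|h]; last first.
    by have [k zk] := h a aA; have := zA k; rewrite zk.
  have /= := @closed_connect _ _ (fun v => v == q l) _ _ _ (cA _ _ (qP l) aA).
  rewrite eqxx; apply=> // u v /eqP uq /and3P [uv uA vA]; apply: contraT => vq.
  have [|k zk] := noe l u v uA vA uv; first by rewrite eq_sym uq.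
  by have := zA k; rewrite zk vA.
split=> [i iJ|i j iJ jJ ij].
  by apply/setP => a; rewrite inE; apply/idP/eqP => [/(single i a iJ)|->].
have [[a [b [aA bA ab]]]|[[k zk] _]] := At i j ij.
  by rewrite -(single _ _ iJ aA) -(single _ _ jJ bA).
by move: iJ; rewrite inE => /forallP/(_ k); rewrite zk.
Qed.

(** Induction on |V|. An edge inside a branch set with a non-terminal end y is contracted, unless a
    separation of order |K| has both ends in its middle; then [linkage_sep] passes to the smaller
    set Y. With no such edge left, at least |K| branch sets form a clique of single vertices, to
    which Menger's theorem leads the terminals. *)
Theorem hub_linked e V z A (s : K -> K) : symmetric e -> involutive s ->
  2 * #|K| <= #|I| -> hub e V z A -> linkage e V z s.
Proof.
move=> es ss KI.
have [/card0_eq K0 _|K0] := posnP #|K|.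
  by exists (fun _ => set0); split=> k; have := K0 k.
move: {2}#|V|.+1 (ltnSn #|V|) => n.
elim: n e V z A es => // n IH e V z A es Vn H.
have [zi zV AV An Ad Ac At As] := H.
have [/existsP [i /existsP [x /existsP [y /and5P [xA yA xy nxy zy]]]] | noe] :=
  boolP [exists i, exists x, exists y,
    [&& x \in A i, y \in A i, e x y, x != y & [forall k, z k != y]]].
  have xV := subsetP (AV i) _ xA; have yV := subsetP (AV i) _ yA; move/forallP in zy.
  pose sepb (p : {set T} * {set T} * I) := let: (X, Y, j) := p in
    [&& X :|: Y == V, [forall a in X :\: Y, forall b in Y :\: X, ~~ e a b],
      [forall k, z k \in X] &
      [&& x \in X :&: Y, y \in X :&: Y, [disjoint X & A j] & #|X :&: Y| <= #|K|]].
  have [/existsP [[[X Y] j]]|nosep] := boolP [exists p, sepb p].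
    case/and4P=> /eqP XYV /forall_inP nXY /forallP zX /and4P [xXY yXY dX cX].
    have sXY : separation e V X Y by split=> // a b /nXY/forall_inP; apply.
    have cXY : #|X :&: Y| = #|K|.
      apply/eqP; rewrite eqn_leq cX leqNgt; apply/negP => lt.
      by have [a aX aA] := As X Y j sXY zX lt; apply: (disjoint_in dX aX aA).
    apply: (@linkage_sep _ _ _ e V z A s X Y j) => //; first lia.
    move=> z' H'; apply: IH H' => //; rewrite -ltnS; apply: leq_trans Vn; rewrite ltnS.
    have subY : Y \subset V by rewrite -XYV subsetUr.
    rewrite proper_card // properE subY /=; apply/negP => VY.
    (* Y is a proper part of V: otherwise X would have |K| elements and consist of the terminals,
       but it contains y. *)
    have XY : X :&: Y = X by apply/setIidPl/(subset_trans _ VY); rewrite -XYV subsetUl.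
    have /eqP zX' : z @: K == X.
      rewrite eqEcard card_imset // -cXY XY leqnn andbT.
      by apply/subsetP => _ /imsetP [k _ ->].
    by move: yXY; rewrite XY -zX' => /imsetP [k _ yk]; have := zy k; rewrite yk eqxx.
  apply: (linkage_contract es xy) => //; apply: IH.
  - exact: contract_sym.
  - by rewrite -ltnS; apply: leq_trans Vn; rewrite ltnS (cardsD1 y V) yV.
  - apply: (hub_contract es xy nxy xA yA zy H) => X Y j [XYV nXY] zX xXY yXY dX cX.
    case/negP: nosep; apply/existsP; exists (X, Y, j); rewrite /sepb XYV eqxx /=.
    rewrite xXY yXY dX cX !andbT; apply/andP; split; last exact/forallP.
    by apply/forall_inP => a aX; apply/forall_inP => b; apply: nXY.
have noe' i x y : x \in A i -> y \in A i -> e x y -> x != y -> exists k, z k = y.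
  move=> xA yA xy nxy.
  have [/existsP [k /eqP]|/existsPn zy] := boolP [exists k, z k == y]; first by exists k.
  case/negP: noe; apply/existsP; exists i; apply/existsP; exists x.
  by apply/existsP; exists y; rewrite xA yA xy nxy; apply/forallP.
have [J cJ [q [qA [Aq qJ]]]] := hub_clique es H noe'.
have [|F [cF dF zF qF]] := @menger_terminals T K z (within e V) (q @: J) zi (within_sym _ es).
  move=> C Ck.
  have qi : injective q.
    move=> i j qij; apply/eqP; apply: contraT => ij.
    by case: (disjoint_in (Ad i j ij) (qA i)); rewrite qij.
  have [i iJ qC] : exists2 i, i \in J & q i \notin C.
    apply/exists_inP; apply: contraLR Ck => /exists_inPn h; rewrite -leqNgt.
    have : q @: J \subset C by apply/subsetP => _ /imsetP [i iJ ->]; have := h i iJ; rewrite negbK.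
    by move/subset_leq_card; rewrite card_imset //; lia.
  pose r := within (within e V) (~: C).
  pose R := [set v | [exists k, (z k \notin C) && connect r (z k) v]].
  have RV v : v \in R -> (v \in V) && (v \notin C).
    rewrite inE => /existsP [k /andP [kC kv]]; rewrite andbC -in_setD.
    apply: (closed_connect_in _ kv) => [a b _ /and3P [/and3P [_ _ bX] _ bC]|].
      by rewrite in_setD bX andbT -in_setC.
    by rewrite in_setD kC zV.
  have [|k||a aR aA] := As (R :|: (C :&: V)) (V :\: R) i.
  - split.
      apply/setP => a; rewrite !in_setU in_setD in_setI.
      have := RV a; case: (a \in R) => /= [/(_ isT)/andP [-> _] //|_].
      by case: (a \in V); rewrite ?orbT ?andbF.
    move=> a b /setDP [aS aS'] /setDP [bS' bS]; apply/negP => ab.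
    have aR : a \in R.
      move: aS aS'; rewrite in_setU in_setD in_setI.
      by case: (a \in R) => //= /andP [_ ->].
    have /andP [aV aC] := RV a aR; move: bS'; rewrite in_setD => /andP [bR bV].
    move: bS; rewrite in_setU in_setI bV andbT negb_or (negPf bR) /= => bC.
    case/negP: bR; move: aR; rewrite !in_set => /existsP [k /andP [kC ka]].
    apply/existsP; exists k; rewrite kC; apply: (connect_trans ka); apply: connect1.
    by apply/and3P; rewrite !inE aC bC; split=> //; apply/and3P.
  - rewrite in_setU in_setI zV andbT orbC; case kC: (z k \in C) => //=.
    by rewrite in_set; apply/existsP; exists k; rewrite kC connect0.
  - apply: leq_ltn_trans Ck; apply: subset_leq_card; apply/subsetP => a.
    rewrite in_setI in_setU in_setI in_setD.
    by case: (a \in R) => //= /andP [/andP []].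
  move: aA; rewrite (Aq i iJ) => /set1P aq; move: aR; rewrite aq in_setU in_setI (negPf qC) orbF.
  rewrite in_set => /existsP [k /andP [kC ka]]; exists (z k), (q i).
  by rewrite !in_setD kC qC !imset_f.
have [b bP] : exists b : K -> I, forall k, (b k \in J) && (q (b k) \in F k).
  apply: (@fin_all_exists _ _ (fun k t => (t \in J) && (q t \in F k))) => k.
  by have [_ /imsetP [i iJ ->] qF'] := qF k; exists i; rewrite iJ.
have cF' k : conn e (F k) by apply: conn_mono (cF k) => u v /and3P [].
(* The two sets are joined by an edge of the clique, or by the vertex at which both arrive. *)
exists (fun k => F k :|: F (s k)); split.
- move=> k; have /andP [b1 q1] := bP k; have /andP [b2 q2] := bP (s k).
  apply: (connU es (cF' k) (cF' (s k)) q1 q2).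
  by have [->|/qJ ->] := eqVneq (b k) (b (s k)); rewrite ?eqxx ?orbT.
- move=> k; rewrite subUset; apply/andP; split.
  + by apply: (conn_support _ (cF k) (zF k)) => [u v /and3P [_ -> ->]|].
  + by apply: (conn_support _ (cF (s k)) (zF _)) => [u v /and3P [_ -> ->]|].
- by move=> k; rewrite !in_setU !zF orbT.
- move=> k l lk lsk; apply/pred0P => v /=; apply/negP => /andP [].
  have slk : s l != k by apply: contraNneq lsk => <-; rewrite ss.
  have slsk : s l != s k by rewrite (inj_eq (inv_inj ss)).
  rewrite !in_setU => /orP [v1|v1] /orP [v2|v2].
  + by apply: (disjoint_in (dF l k lk)) v2 v1.
  + by apply: (disjoint_in (dF _ _ slk)) v2 v1.
  + by apply: (disjoint_in (dF _ _ lsk)) v2 v1.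
  + by apply: (disjoint_in (dF _ _ slsk)) v2 v1.
Qed.
End HubLinkage.

(** * Highly connected subgraphs and dense minors *)

Section Degrees.
Variable T : finType.
Implicit Types (e : rel T) (V X Y : {set T}).

Definition deg e V v : nat := #|[set w in V | e v w]|.

(* Twice the number of edges inside V. *)
Definition arcs e V : nat := \sum_(v in V) deg e V v.

Lemma degE e V v : deg e V v = \sum_(w in V) e v w.
Proof.
rewrite /deg -sum1_card big_mkcond [RHS]big_mkcond; apply: eq_bigr => w _.
by rewrite inE; case: (w \in V); case: (e v w).
Qed.

Lemma deg_le_card e V v : deg e V v <= #|V|.
Proof. by apply/subset_leq_card/subsetP => w; rewrite inE => /andP []. Qed.

Lemma deg_lt_card e V v : irreflexive e -> v \in V -> deg e V v < #|V|.
Proof.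
move=> ei vV; apply: proper_card; apply/properP; split.
  by apply/subsetP => w; rewrite inE => /andP [].
by exists v; rewrite // inE ei andbF.
Qed.

Lemma arcsE e V : arcs e V = \sum_v \sum_w within e V v w.
Proof.
rewrite /arcs big_mkcond; apply: eq_bigr => v _; case: ifP => vV; last first.
  by rewrite big1 // => w _; rewrite /within /= vV andbF.
rewrite degE big_mkcond; apply: eq_bigr => w _.
by rewrite /within /= vV; case: (w \in V); rewrite ?andbT ?andbF.
Qed.

Lemma arcs_D1 e V v : symmetric e -> irreflexive e -> v \in V ->
  arcs e V = arcs e (V :\ v) + 2 * deg e V v.
Proof.
move=> es ei vV; rewrite /arcs (big_setD1 v vV) /=.
have dD w : deg e V w = e w v + deg e (V :\ v) w by rewrite !degE (big_setD1 v vV).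
rewrite (eq_bigr (fun w => e w v + deg e (V :\ v) w)); last by move=> w _; apply: dD.
rewrite big_split /=.
have -> : \sum_(i in V :\ v) e i v = deg e V v.
  rewrite degE (big_setD1 v vV) /= ei add0n.
  by apply: eq_bigr => w _; rewrite es.
lia.
Qed.

Lemma arcs_le e V d : (forall v, v \in V -> d <= deg e V v) -> d * #|V| <= arcs e V.
Proof. by move=> h; rewrite mulnC -sum_nat_const; apply: leq_sum. Qed.

Lemma arcs_lt_sqr e V : irreflexive e -> 0 < #|V| -> arcs e V <= #|V| * #|V|.-1.
Proof.
move=> ei V0; rewrite -sum_nat_const; apply: leq_sum => v vV.
by have := deg_lt_card ei vV; lia.
Qed.

Lemma arcs_separation e V X Y : separation e V X Y -> symmetric e ->
  arcs e V <= arcs e X + arcs e Y.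
Proof.
case=> XYV nXY es; rewrite !arcsE -big_split; apply: leq_sum => v _.
rewrite -big_split; apply: leq_sum => w _ /=; rewrite /within /= -XYV !inE.
case vw: (e v w) => //=.
have := nXY v w; rewrite vw; have := nXY w v; rewrite es vw !inE.
case: (v \in X); case: (v \in Y); case: (w \in X); case: (w \in Y) => //=;
  by [move=> /(_ isT isT) | move=> _ /(_ isT isT)].
Qed.

(** Take a minimal U with |U| >= 2k and more than g (|U| - k) edges. Deleting a vertex of degree at
    most g would preserve both conditions. If a separation had at most k vertices in its middle,
    both sides would be smaller, hence have too few edges, and U would have at most g (|X| + |Y| -
    2k) <= g (|U| - k). *)
Lemma mader_connected e V g k : symmetric e -> irreflexive e ->
  0 < k -> 2 * k <= g -> 0 < #|V| -> (forall v, v \in V -> 2 * g <= deg e V v) ->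
  exists2 U : {set T}, U \subset V & [/\ 0 < #|U|, forall v, v \in U -> g < deg e U v &
    forall X Y a b, separation e U X Y -> a \in X :\: Y -> b \in Y :\: X -> k < #|X :&: Y|].
Proof.
move=> es ei k0 kg V0 dV.
pose P (U : {set T}) := [&& U \subset V, 2 * k <= #|U| & 2 * g * (#|U| - k) < arcs e U].
have PV : P V.
  rewrite /P subxx /=; have /card_gt0P [v vV] := V0.
  have V2 : 2 * g < #|V| by apply: leq_ltn_trans (dV v vV) (deg_lt_card ei vV).
  apply/andP; split; first lia.
  have := arcs_le dV; nia.
case: (arg_minnP (fun U : {set T} => #|U|) PV) => U /and3P [UV kU aU] minU.
(* Exactly 2k vertices span too few edges because 2k <= g; so a vertex can be deleted from U without
   violating the size condition. *)
have gtU : 2 * k < #|U|.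
  rewrite ltn_neqAle kU andbT; apply/eqP => Uk.
  have := arcs_lt_sqr ei (_ : 0 < #|U|); move: aU; rewrite -Uk; nia.
have dU v : v \in U -> g < deg e U v.
  move=> vU; rewrite ltnNge; apply/negP => dv.
  have := minU (U :\ v); have := cardsD1 v U; rewrite vU add1n => cU.
  rewrite cU ltnn => h; suff : false by []; apply: h; apply/and3P; split.
  - by apply: subset_trans UV; apply: subsetDl.
  - lia.
  - have := arcs_D1 es ei vU; nia.
exists U => //; split=> //; first lia.
move=> X Y a b sep aXY bYX; rewrite ltnNge; apply/negP => cXY.
have side X' Y' c d : separation e U X' Y' -> c \in X' :\: Y' -> d \in Y' :\: X' ->
    2 * k <= #|X'| /\ arcs e X' <= 2 * g * (#|X'| - k).
  move=> [XYU nXY] cX dY; have subX : X' \subset U by rewrite -XYU subsetUl.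
  have cU : c \in U by move: cX; rewrite inE => /andP [_ /(subsetP subX)].
  have X2 : 2 * k <= #|X'|.
    apply: (leq_trans kg); apply: ltnW; apply: leq_trans (dU c cU) _.
    apply/subset_leq_card/subsetP => w; rewrite inE => /andP [wU cw].
    apply: contraT => wX; have := nXY c w cX; rewrite inE wX cw /=; apply.
    by move: wU; rewrite -XYU inE (negPf wX).
  split=> //; rewrite leqNgt; apply/negP => aX.
  have : #|U| <= #|X'| by apply: minU; rewrite /P X2 aX (subset_trans subX UV).
  rewrite leqNgt => /negP; apply; apply: proper_card; apply/properP; split=> //.
  by move: dY; rewrite inE => /andP [dX dY]; exists d; rewrite // -XYU inE dY orbT.
have [X2 aX] := side X Y a b sep aXY bYX.
have sep' : separation e U Y X.
  by case: sep => XYU nXY; split=> [|c d cY dX]; rewrite 1?setUC // es nXY.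
have [Y2 aY] := side Y X b a sep' bYX aXY.
have := arcs_separation sep es; have := cardsUI X Y; case: sep => -> _; nia.
Qed.

Definition clique_model e V s := exists B : 'I_s -> {set T},
  [/\ forall i, B i \subset V, forall i, exists a, a \in B i, forall i, conn e (B i),
      forall i j, i != j -> [disjoint B i & B j] &
      forall i j, i != j -> touch e (B i) (B j)].

Lemma clique_model_sub e X Y s : X \subset Y -> clique_model e X s -> clique_model e Y s.
Proof. by move=> XY [B [h1 h2 h3 h4 h5]]; exists B; split=> // i; apply: subset_trans XY. Qed.

Lemma clique_model_contract e V x y s : symmetric e -> e x y -> x \in V -> y \in V ->
  clique_model (contract e x y) (V :\ y) s -> clique_model e V s.
Proof.
move=> es xy xV yV [B [BV Bn Bc Bd Bt]].
have yB i : y \notin B i by apply/negP => /(subsetP (BV i)); rewrite !inE eqxx.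
exists (fun i => uncontract x y (B i)); split.
- move=> i; apply/subsetP => a; rewrite in_uncontract => /orP [|/andP [/eqP->//]].
  by move/(subsetP (BV i)); rewrite inE => /andP [].
- by move=> i; have [a aB] := Bn i; exists a; rewrite in_uncontract aB.
- by move=> i; apply: conn_uncontract.
- by move=> i j ij; apply: disjoint_uncontract => //; apply: Bd.
- by move=> i j ij; apply: touch_uncontract; apply: Bt.
Qed.

Definition codeg e V x y : nat := #|[set w in V | e x w && e y w]|.

(** Contraction loses the edge xy and one edge per common neighbour. In the proof [n] marks the
    neighbours of y that are new to x. *)
Lemma arcs_contract e V x y : symmetric e -> irreflexive e -> e x y -> x \in V -> y \in V ->
  arcs e V <= arcs (contract e x y) (V :\ y) + 2 * (codeg e V x y).+1.
Proof.
move=> es ei xy xV yV; rewrite (arcs_D1 es ei yV).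
have nxy : x != y by apply: contraTneq xy => ->; rewrite ei.
pose n b := [&& b != x, e y b & ~~ e x b].
have xVy : x \in V :\ y by rewrite !inE nxy.
have -> : deg e V y = (codeg e V x y).+1 + \sum_(b in V :\ y) n b.
  rewrite degE (big_setD1 y yV) /= ei add0n.
  have -> : codeg e V x y = \sum_(b in V :\ y) (e x b && e y b).
    rewrite /codeg -sum1_card big_mkcond [RHS]big_mkcond; apply: eq_bigr => w _.
    rewrite !inE; have [->|_] := eqVneq w y; first by rewrite ei !andbF.
    by rewrite /=; case: (w \in V); case: (e x w); case: (e y w).
  rewrite !(big_setD1 x xVy) /= [e y x]es xy ei /n eqxx /= !addSn !add0n -big_split /=.
  congr _.+1.
  apply: eq_bigr => w; rewrite !inE => /andP [/negPf-> _].
  by case: (e x w); case: (e y w).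
suff : arcs e (V :\ y) + 2 * (\sum_(b in V :\ y) n b) <= arcs (contract e x y) (V :\ y) by lia.
have -> : 2 * (\sum_(b in V :\ y) n b) =
    \sum_(a in V :\ y) \sum_(b in V :\ y) (((a == x) && n b) + ((b == x) && n a)).
  under [RHS]eq_bigr => a aV do rewrite big_split /=.
  rewrite big_split /= mul2n -addnn; congr (_ + _).
    rewrite [RHS](big_setD1 x xVy) /= eqxx [X in _ + X]big1 ?addn0.
      by apply: eq_bigr => b _; case: (n b).
    by move=> a; rewrite !inE => /andP [/negPf-> _]; rewrite big1.
  apply: eq_bigr => a _; rewrite (big_setD1 x xVy) /= eqxx big1 ?addn0.
    by case: (n a).
  by move=> b; rewrite !inE => /andP [/negPf-> _].
rewrite /arcs -big_split; apply: leq_sum => a aV /=; rewrite !degE -big_split.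
apply: leq_sum => b bV /=; move: aV bV; rewrite !inE => /andP [ay aV] /andP [bY bV].
rewrite /contract /= ay bY /= /n; have [->|ab] := eqVneq a b.
  by rewrite ei; case: (eqVneq b x) => [->|_]; rewrite /= ?eqxx.
rewrite /=; have [ax|ax] := eqVneq a x; have [bx|bx] := eqVneq b x => /=.
- by rewrite ax bx eqxx in ab.
- by rewrite ax orbF; case: (e x b); case: (e y b).
- by rewrite bx [e a x]es [e a y]es; case: (e x a); case: (e y a).
- by rewrite orbF; case: (e a b).
Qed.

Lemma dense_minor e V k s : symmetric e -> irreflexive e -> 0 < k -> 0 < #|V| ->
  2 * k * #|V| <= arcs e V ->
  (forall e' (H : {set T}), symmetric e' -> irreflexive e' -> k <= #|H| ->
     (forall w, w \in H -> #|H| < 2 * (deg e' H w).+1) -> clique_model e' H s) ->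
  clique_model e V s.
Proof.
move=> es ei k0 V0 aV dense; move: {2}#|V|.+1 (ltnSn #|V|) => n.
elim: n e V es ei V0 aV => // n IH e V es ei V0 aV Vn.
have [v vV vmin] : exists2 v, v \in V & forall w, w \in V -> deg e V v <= deg e V w.
  by have /card_gt0P [v vV] := V0; case: (arg_minnP (deg e V) vV) => w wV h; exists w.
have dn : deg e V v * #|V| <= arcs e V by apply: arcs_le.
have cV : #|V| = #|V :\ v|.+1 by rewrite (cardsD1 v V) vV.
have V1 : 1 < #|V|.
  rewrite ltn_neqAle V0 andbT; apply/eqP => V1.
  have := arcs_lt_sqr ei V0; rewrite -V1; nia.
have [dv0|dv0] := posnP (deg e V v).
  apply: (clique_model_sub (subsetDl V [set v])); apply: IH => //; try lia.
  have := arcs_D1 es ei vV; rewrite dv0; nia.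
(* Codegrees are compared with the current average degree, not with k: if no edge qualifies, the
   neighbourhood of a vertex of minimum degree is dense relative to its own size. *)
have [/existsP [x /existsP [y /and4P [xV yV xy cxy]]]|nc] := boolP [exists x, exists y,
    [&& x \in V, y \in V, e x y & 2 * (codeg e V x y).+1 * #|V| <= arcs e V]].
  have := arcs_contract es ei xy xV yV => aV'.
  have cVy : #|V| = #|V :\ y|.+1 by rewrite (cardsD1 y V) yV.
  apply: (clique_model_contract es xy xV yV); apply: IH.
  - exact: contract_sym.
  - by move=> a; rewrite /contract /= eqxx !andbF.
  - lia.
  (* If the loss per vertex exceeds k, density survives because [arcs] is then at least 2 (codeg +
     1) |V|. *)
  - by have [|] := leqP (codeg e V x y).+1 k; nia.
  - lia.
have nc' w : w \in V -> e v w -> arcs e V < 2 * (codeg e V v w).+1 * #|V|.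
  move=> wV vw; rewrite ltnNge; apply: contra nc => h.
  by apply/existsP; exists v; apply/existsP; exists w; rewrite vV wV vw.
pose H := [set w in V | e v w].
have HV : H \subset V by apply/subsetP => w; rewrite inE => /andP [].
have cdeg w : codeg e V v w = deg e H w.
  by rewrite /codeg /deg; apply: eq_card => u; rewrite !inE andbA.
apply: (clique_model_sub HV); apply: dense => //.
  have /card_gt0P [w wH] := dv0; move: (wH); rewrite inE => /andP [wV vw].
  have := nc' w wV vw; rewrite cdeg; have := deg_lt_card ei wH; rewrite -/(deg e V v) -/H; nia.
move=> w; rewrite inE => /andP [wV vw]; have := nc' w wV vw; rewrite cdeg.
rewrite -/(deg e V v) in dn *; move: dn; rewrite /deg -/H; nia.
Qed.
End Degrees.

(** * Clique minors of dense graphs *)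

Section Dense.
Variables (T : finType) (e : rel T).
Hypotheses (es : symmetric e) (ei : irreflexive e).
Implicit Types (X Y W Q U H C : {set T}).

Definition short_linked Y w := forall W x y, #|W| <= w ->
  x \in Y :\: W -> y \in Y :\: W ->
  exists Q, [/\ Q \subset Y :\: W, conn e Q, x \in Q, y \in Q & #|Q| <= 6].

Lemma card_nbrs_diff Y W v : deg e Y v <= #|[set u in Y :\: W | e v u]| + #|W|.
Proof.
apply: leq_trans (leq_card_setU _ _); apply/subset_leq_card/subsetP => u.
by rewrite !inE => /andP [-> ->]; case: (u \in W); rewrite ?orbT.
Qed.

(** Branch sets are built one at a time. The s earlier ones have at most 6 s^2 <= w vertices in all
    and can be deleted; a fresh vertex b then reaches a neighbour of each by at most 6 vertices, so
    the new set has at most 6 s + 1. *)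
Lemma greedy_model Y w s : short_linked Y w -> w < #|Y| ->
  (forall v, v \in Y -> w < deg e Y v) -> 6 * s ^ 2 <= w -> clique_model e Y s.
Proof.
move=> lY wY dY sw.
suff [B [BY Bn Bc Bd Bt] _] : exists2 B : 'I_s -> {set T},
    [/\ forall i, B i \subset Y, forall i, exists a, a \in B i, forall i, conn e (B i),
      forall i j, i != j -> [disjoint B i & B j] &
      forall i j, i != j -> touch e (B i) (B j)] & #|\bigcup_i B i| <= 6 * s ^ 2.
  by exists B.
elim: s sw => [|s IH] sw.
  exists (fun _ => set0); first by split=> -[].
  by rewrite big1 // cards0.
have [|B [BY Bn Bc Bd Bt] cU] := IH; first by nia.
set U := \bigcup_i B i in cU; have Uw : #|U| <= w by nia.
have BU i : B i \subset U by apply: bigcup_sup.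
have [b bY bU] : exists2 b, b \in Y & b \notin U.
  apply/exists_inP; apply: contraLR wY => /exists_inPn h; rewrite -leqNgt.
  by apply: leq_trans Uw; apply/subset_leq_card/subsetP => v vY; have := h v vY; rewrite negbK.
have [Q QP] : exists Q : 'I_s -> {set T}, forall i,
   [/\ Q i \subset Y :\: U, conn e (Q i), b \in Q i, touch e (B i) (Q i) & #|Q i| <= 6].
  apply: (@fin_all_exists _ _ (fun i Q => [/\ Q \subset Y :\: U, conn e Q, b \in Q,
    touch e (B i) Q & #|Q| <= 6])) => i; have [a aB] := Bn i.
  have [c cY ac] : exists2 c, c \in Y :\: U & e a c.
    have := card_nbrs_diff Y U a; have := dY a (subsetP (BY i) a aB).
    have [/card0_eq h|/card_gt0P [c]] := posnP #|[set u in Y :\: U | e a u]|.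
      by rewrite (eq_card0 h); lia.
    by rewrite inE => /andP [cY ac]; exists c.
  have [|Q [QY Qc bQ cQ c6]] := lY U b c Uw _ cY; first by rewrite inE bU bY.
  by exists Q; split=> //; exists a, c.
pose B0 := b |: \bigcup_i Q i.
have QB0 i : Q i \subset B0 by apply: subset_trans (subsetUr _ _); apply: bigcup_sup.
have B0Y : B0 \subset Y :\: U.
  rewrite subUset sub1set inE bU bY /=; apply/bigcupsP => i _.
  by case: (QP i).
have cB0 : conn e B0.
  have h a : a \in B0 -> connect (within e B0) b a.
    case/setU1P => [->|/bigcupP [i _ aQ]]; first exact: connect0.
    have [_ Qc bQ _ _] := QP i; apply: connect_mono (Qc b a bQ aQ).
    by apply: within_sub.
  move=> a a' /h ba /h; apply: connect_trans.
  by rewrite (sym_connect_sym (within_sym B0 es)).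
have cardB0 : #|B0| <= 6 * s + 1.
  rewrite addnC cardsU1 leq_add //; first by case: (_ \notin _).
  rewrite -[X in _ * X]card_ord mulnC -sum_nat_const.
  apply: (@leq_trans (\sum_(i < s) #|Q i|)); last by apply: leq_sum => i _; case: (QP i).
  apply: (big_ind2 (fun X n => #|X| <= n)) => [|X n X' n' Xn Xn'|//]; first by rewrite cards0.
  by apply: leq_trans (leq_card_setU _ _) _; apply: leq_add.
pose B' (i : 'I_s.+1) := if unlift ord0 i is Some j then B j else B0.
have B'0 : B' ord0 = B0 by rewrite /B' unlift_none.
have B'S j : B' (lift ord0 j) = B j by rewrite /B' liftK.
have dB0 j : [disjoint B0 & B j].
  apply/pred0P => a /=; apply/negP => /andP [/(subsetP B0Y)]; rewrite inE => /andP [aU _].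
  by move/(subsetP (BU j)); rewrite (negPf aU).
have tB0 j : touch e (B j) B0.
  by have [_ _ _ [a [c [aB cQ ac]]] _] := QP j; exists a, c; rewrite aB ac (subsetP (QB0 j)).
have tsym X X' : touch e X X' -> touch e X' X.
  by move=> [a [c [aX cX ac]]]; exists c, a; rewrite es.
exists B'.
  split.
  - move=> i; case: (unliftP ord0 i) => [j|] ->; rewrite ?B'S ?B'0 //.
    by apply: subset_trans B0Y _; apply: subsetDl.
  - move=> i; case: (unliftP ord0 i) => [j|] ->; rewrite ?B'S ?B'0 //.
    by exists b; rewrite !inE eqxx.
  - by move=> i; case: (unliftP ord0 i) => [j|] ->; rewrite ?B'S ?B'0.
  - move=> i i'; case: (unliftP ord0 i) => [j|] ->; case: (unliftP ord0 i') => [j'|] ->;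
      rewrite ?B'S ?B'0 ?eqxx //.
    + by rewrite (inj_eq lift_inj); apply: Bd.
    + by rewrite disjoint_sym.
  - move=> i i'; case: (unliftP ord0 i) => [j|] ->; case: (unliftP ord0 i') => [j'|] ->;
      rewrite ?B'S ?B'0 ?eqxx //.
    + by rewrite (inj_eq lift_inj); apply: Bt.
    + by move=> _; apply: tsym.
rewrite big_ord_recl B'0; under eq_bigr => j _ do rewrite B'S.
by apply: leq_trans (leq_card_setU _ _) _; rewrite -/U; nia.
Qed.

Lemma conn_triple x a z : (x == a) || e x a -> (a == z) || e a z -> conn e [set x; a; z].
Proof.
move=> xa az; apply: (@connU _ _ _ _ a z) => //; try exact: conn1.
- by apply: (@connU _ _ _ _ x a); rewrite ?inE //; apply: conn1.
- by rewrite !inE eqxx orbT.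
- by rewrite inE.
Qed.

Lemma card_set3 (x a z : T) : #|[set x; a; z]| <= 3.
Proof. by rewrite !cardsU !cards1; lia. Qed.

Definition ball2 Y x := [set z in Y | [exists a in Y, ((x == a) || e x a) && ((a == z) || e a z)]].

Lemma ball2P Y x z : x \in Y -> z \in ball2 Y x ->
  exists Q, [/\ Q \subset Y, conn e Q, x \in Q, z \in Q & #|Q| <= 3].
Proof.
rewrite inE => xY /andP [zY /exists_inP [a aY /andP [xa az]]].
exists [set x; a; z]; split; rewrite ?card_set3 ?inE ?eqxx ?orbT //; last exact: conn_triple.
by rewrite !subUset !sub1set xY aY zY.
Qed.

(** If the balls of radius 2 about x and y neither meet nor touch, they cover Y: a vertex outside
    both would give, with x and y, three disjoint neighbourhoods of size at least d. So the ball
    about x is a union of components. *)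
Lemma short_or_closed Y x y d : x \in Y -> y \in Y ->
  (forall v, v \in Y -> d <= deg e Y v) -> #|Y| < 3 * d ->
  (exists Q, [/\ Q \subset Y, conn e Q, x \in Q, y \in Q & #|Q| <= 6]) \/
  [/\ x \in ball2 Y x, y \in Y :\: ball2 Y x &
    forall u v, u \in ball2 Y x -> v \in Y -> e u v -> v \in ball2 Y x].
Proof.
move=> xY yY dY Yd.
have bb v : v \in Y -> v \in ball2 Y v.
  by move=> vY; rewrite inE vY; apply/exists_inP; exists v; rewrite ?eqxx.
have [/existsP [u /existsP [v /and3P [uX vZ uv]]]|h] := boolP [exists u, exists v,
   [&& u \in ball2 Y x, v \in ball2 Y y & (u == v) || e u v]].
  left; have [P [PY Pc xP uP P3]] := ball2P xY uX; have [R [RY Rc yR vR R3]] := ball2P yY vZ.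
  exists (P :|: R); split; rewrite ?inE ?xP ?yR ?orbT //.
  - by rewrite subUset PY RY.
  - exact: (connU es Pc Rc uP vR uv).
  - by apply: leq_trans (leq_card_setU _ _) _; lia.
have far u v : u \in ball2 Y x -> v \in ball2 Y y -> ~~ ((u == v) || e u v).
  move=> uX vZ; apply: contra h => uv; apply/existsP; exists u; apply/existsP; exists v.
  by rewrite uX vZ.
have cover z : z \in Y -> (z \in ball2 Y x) || (z \in ball2 Y y).
  move=> zY; apply: contraLR Yd => /norP [zx zy]; rewrite -leqNgt.
  pose N v := [set w in Y | e v w].
  have NN u v : u \in Y -> v \in Y -> v \notin ball2 Y u -> N u :&: N v = set0.
    move=> uY vY h'; apply/setP => a; rewrite !inE; apply: contraNF h'.
    case/andP => /andP [aY ua] /andP [_ va]; rewrite inE vY; apply/exists_inP; exists a => //.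
    by rewrite ua [e a v]es va !orbT.
  have yx : y \notin ball2 Y x by apply/negP => yx; have := far y y yx (bb y yY); rewrite eqxx.
  have c1 := cardsUI (N x) (N y); rewrite NN // cards0 addn0 in c1.
  have c2 := cardsUI (N x :|: N y) (N z).
  rewrite setIUl NN // NN // setU0 cards0 addn0 in c2.
  have : #|N x :|: N y :|: N z| <= #|Y|.
    by apply/subset_leq_card/subsetP => a; rewrite !inE => /orP [/orP []|] /andP [].
  by have := dY x xY; have := dY y yY; have := dY z zY; rewrite /deg -/(N x) -/(N y) -/(N z); lia.
right; split; first exact: bb.
- by rewrite inE yY andbT; apply/negP => yx; have := far y y yx (bb y yY); rewrite eqxx.
- move=> u v uX vY uv; have := cover v vY; case/orP => // vZ.
  by have := far u v uX vZ; rewrite uv orbT.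
Qed.

(** After w deletions the degrees still exceed a third of the vertices. Either short connections
    always remain, or some deletion leaves a closed set C of at most |H|/2 vertices. There every
    vertex misses only about w others, so any two vertices have a common neighbour even after w
    further deletions. *)
Lemma dense_clique_model H w s : 0 < w -> 20 * w <= #|H| ->
  (forall v, v \in H -> #|H| < 2 * (deg e H v).+1) -> 6 * s ^ 2 <= w ->
  clique_model e H s.
Proof.
move=> w0 wH dH sw.
pose X2 (p : {set T} * {set T}) := [&& #|p.1| <= w,
   p.2 \subset H :\: p.1, p.2 != set0, 2 * #|p.2| <= #|H| &
   [forall u in p.2, forall v in H :\: p.1, e u v ==> (v \in p.2)]].
have [/existsP [[W C] /and5P [/= cW CH C0 C2 /forall_inP Ccl]]|nX] := boolP [exists p, X2 p].
  have CH' : C \subset H by apply: subset_trans CH (subsetDl _ _).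
  have dC v : v \in C -> #|H| <= 2 * (deg e C v + w) + 1.
    move=> vC; have := dH v (subsetP CH' v vC); have := card_nbrs_diff H W v.
    suff : #|[set u in H :\: W | e v u]| <= deg e C v by lia.
    apply/subset_leq_card/subsetP => u; rewrite inE => /andP [uH vu].
    have /forall_inP/(_ u uH) := Ccl v vC.
    by rewrite vu /= inE => ->.
  have C1 : exists v, v \in C by apply/set0Pn.
  apply: (clique_model_sub CH'); apply: (greedy_model (w := w)) => //; last first.
  - by move=> v /dC; lia.
  - by have [v /dC] := C1; have := deg_le_card e C v; lia.
  move=> W' x y cW' xC yC.
  have [xC' yC'] : x \in C /\ y \in C by move: xC yC; rewrite !inE => /andP [_ ->] /andP [_ ->].
  have [c] : exists c, c \in ([set u in C | e x u] :&: [set u in C | e y u]) :\: W'.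
    apply/card_gt0P; have := cardsUI [set u in C | e x u] [set u in C | e y u].
    have : #|[set u in C | e x u] :|: [set u in C | e y u]| <= #|C|.
      by apply/subset_leq_card/subsetP => u; rewrite !inE => /orP [] /andP [].
    have := dC x xC'; have := dC y yC'; rewrite /deg cardsD.
    set S := _ :&: [set u in C | e y u]; have : #|S :&: W'| <= #|W'|.
      by apply/subset_leq_card/subsetIr.
    lia.
  rewrite !inE => /and3P [cW1 /andP [cC xc] /andP [_ yc]].
  exists [set x; c; y]; split; rewrite ?inE ?eqxx ?orbT //.
  - by rewrite !subUset !sub1set xC yC inE cW1 cC.
  - by apply: conn_triple; rewrite ?xc ?[e c y]es ?yc orbT.
  - by apply: leq_trans (card_set3 _ _ _) _.
apply: (greedy_model (w := w)) => //; last first.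
- by move=> v /dH; lia.
- lia.
move=> W x y cW xY yY.
have dY v : v \in H :\: W -> 6 * w < deg e (H :\: W) v.
  rewrite inE => /andP [_ vH]; have := dH v vH; have := card_nbrs_diff H W v.
  by rewrite -/(deg e (H :\: W) v); lia.
have dY' v : v \in H :\: W -> #|H| <= 2 * (deg e (H :\: W) v + w) + 1.
  rewrite inE => /andP [_ vH]; have := dH v vH; have := card_nbrs_diff H W v.
  by rewrite -/(deg e (H :\: W) v); lia.
have cY : #|H :\: W| <= #|H| by apply/subset_leq_card/subsetDl.
have [||//|[xX yX Xcl]] := short_or_closed (d := #|H|./2 - w) xY yY.
- by move=> v vY; have := dY' v vY; lia.
- by lia.
exfalso; case/negP: nX; apply/existsP.
set X := ball2 _ x in xX yX Xcl *.
have XY : X \subset H :\: W by apply/subsetP => z; rewrite inE => /andP [].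
have cX : #|X| + #|(H :\: W) :\: X| = #|H :\: W| by rewrite -(cardsID X (H :\: W)) (setIidPr XY).
have [X2'|X2'] := leqP (2 * #|X|) #|H|.
  exists (W, X); apply/and5P; split=> //=; first by apply/set0Pn; exists x.
  by apply/forall_inP => u uX; apply/forall_inP => v vY; apply/implyP; apply: Xcl.
exists (W, (H :\: W) :\: X); apply/and5P; split=> //=.
- exact: subsetDl.
- by apply/set0Pn; exists y.
- lia.
apply/forall_inP => u; rewrite in_setD => /andP [uX uY]; apply/forall_inP => v vY; apply/implyP => uv.
by rewrite in_setD vY andbT; apply: contra uX => vX; apply: (Xcl v) => //; rewrite es.
Qed.
End Dense.

(** * Subdivisions from large minimum degree *)

Lemma is_path_rev (G : sgraph) (x : G) s y : is_path x s y -> is_path y (rev s) x.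
Proof.
move=> /andP [p u]; apply/andP; split.
  have := rev_path (@adj G) x (rcons s y); rewrite last_rcons belast_rcons rev_cons => ->.
  by rewrite (eq_path (e' := @adj G)) // => a b; apply: adj_sym.
by rewrite -rev_cons -rev_rcons rev_uniq rcons_cons.
Qed.

Lemma subdivision_of_lt (t : nat) (G : sgraph) (phi : 'I_t -> G) (q : 'I_t -> 'I_t -> seq G) :
  injective phi ->
  (forall i j : 'I_t, i < j -> is_path (phi i) (q i j) (phi j)) ->
  (forall i j w : 'I_t, i < j -> phi w \notin q i j) ->
  (forall i j k l : 'I_t, i < j -> k < l -> (i, j) != (k, l) -> ~~ has (mem (q i j)) (q k l)) ->
  has_subdivision (complete_graph t) G.
Proof.
move=> phi_inj qp qi qd; exists phi.
exists (fun i j : 'I_t => if i < j then q i j else rev (q j i)).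
have lt (u v : 'I_t) : u != v -> (u < v) || (v < u) by rewrite -neq_ltn.
have hr s1 s2 : has (mem (rev s1)) s2 = has (mem s1) s2.
  by apply: eq_has => x; rewrite /= mem_rev.
split=> //.
- move=> u v /lt; case: ifP => [uv _|_ vu]; first exact: qp.
  by apply: is_path_rev; apply: qp.
- move=> u v /lt; case: (ltngtP u v) => // uv _; rewrite ?revK //.
- move=> u v w /lt; case: ifP => [uv _|_ vu]; first exact: qi.
  by rewrite mem_rev; apply: qi.
- move=> u v x y /lt uv /lt xy.
  have nq (a b c d : 'I_t) : a < b -> c < d -> [set a; b] != [set c; d] ->
      ~~ has (mem (q a b)) (q c d).
    by move=> ab cd h; apply: qd => //; apply: contraNneq h => -[-> ->].
  move: uv xy; case: ifP => [uv _|_ vu]; case: ifP => [xy _|_ yx] h; rewrite ?hr ?has_rev.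
  + exact: nq.
  + by apply: nq; rewrite // [[set y; x]]setUC.
  + by apply: nq; rewrite // [[set v; u]]setUC.
  + by apply: nq; rewrite // [[set y; x]]setUC [[set v; u]]setUC.
Qed.

(** Each set has at least |K| elements, so a greedy choice never runs out. *)
Lemma distinct_representatives (K T : finType) (S : K -> {set T}) :
  (forall k, #|K| <= #|S k|) -> exists2 f : K -> T, injective f & forall k, f k \in S k.
Proof.
move=> cS.
suff [f fS fi] : exists2 f : K -> T, forall k, f k \in S k & {in enum K &, injective f}.
  by exists f => // k l; apply: fi; rewrite mem_enum.
have : uniq (enum K) by apply: enum_uniq.
elim: (enum K) => [|k r IH] /=.
  have [|f fP] := @fin_all_exists _ _ (fun k t => t \in S k).
    by move=> k; apply/card_gt0P; apply: leq_trans (cS k); apply/card_gt0P; exists k.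
  by exists f.
case/andP=> kr ur; have [f fS fi] := IH ur.
have [a aS ar] : exists2 a, a \in S k & a \notin map f r.
  apply/exists_inP; apply: contraT => /exists_inPn h.
  have : #|S k| <= size (map f r).
    apply: leq_trans (card_size _); apply/subset_leq_card/subsetP => a aS.
    by have := h a aS; rewrite negbK.
  have : size (k :: r) <= #|K| by have /card_uniqP <- : uniq (k :: r); rewrite ?max_card //= kr.
  by rewrite size_map /= => h1 h2; have := leq_trans h1 (leq_trans (cS k) h2); rewrite ltnn.
exists (fun l => if l == k then a else f l); first by move=> l; case: eqP => [->|].
move=> l l'; rewrite !inE => /orP [/eqP->|lr] /orP [/eqP->|lr'] //; rewrite ?eqxx.
- by case: eqP => [->//|_] aE; rewrite aE map_f in ar.
- by case: eqP => [->//|_] aE; rewrite -aE map_f in ar.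
- case: eqP => [lk|_]; first by rewrite lk (negPf kr) in lr.
  case: eqP => [lk|_]; first by rewrite lk (negPf kr) in lr'.
  exact: fi.
Qed.

Lemma conn_path (T : finType) (e : rel T) (X : {set T}) x y : conn e X -> x \in X -> y \in X ->
  exists p, [/\ path e x p, last x p = y, uniq (x :: p) & {subset x :: p <= X}].
Proof.
move=> cX xX yX; have /connectP [p pp ->] := cX x y xX yX.
case/shortenP: pp => p' pp' up' _; exists p'; split=> //.
  by apply: sub_path pp' => a b /and3P [].
have sX : all (fun v => v \in X) p'.
  by elim: p' x {xX up'} pp' => //= a p' IH x /andP [/and3P [_ _ ->]] /IH ->.
by move=> v; rewrite inE => /orP [/eqP->//|/(allP sX)].
Qed.

(** * Linking the leaves of disjoint stars *)

Section Topological.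
Variables (t : nat) (G : sgraph).
Let adjs : symmetric (@adj G) := @adj_sym G.
Let adji : irreflexive (@adj G) := @adj_irr G.

(** The pair (i, j) names a leaf: the neighbour of branch vertex i at which the path towards branch
    vertex j starts. [swap_pair] gives the leaf at the other end of that path. *)
Definition branch_pair : finType := {p : 'I_t * 'I_t | p.1 != p.2}.

Lemma card_branch_pair : #|branch_pair| <= t ^ 2.
Proof.
by rewrite card_sig; apply: leq_trans (max_card _) _; rewrite card_prod !card_ord.
Qed.

Lemma swap_pair_subproof (p : branch_pair) : (val p).2 != (val p).1.
Proof. by rewrite eq_sym (valP p). Qed.

Definition swap_pair (p : branch_pair) : branch_pair :=
  Sub ((val p).2, (val p).1) (swap_pair_subproof p).

Lemma swap_pairK : involutive swap_pair.
Proof. by case=> -[i j] ij; apply: val_inj. Qed.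

Lemma subdivision_of_linkage (V : {set G}) (c : 'I_t -> G) (leaf : branch_pair -> G) :
  injective c -> (forall i, c i \notin V) ->
  (forall p, adj (c (val p).1) (leaf p)) ->
  linkage (@adj G) V leaf swap_pair -> has_subdivision (complete_graph t) G.
Proof.
move=> ci cV cl [Q [cQ QV lQ dQ]].
have [q qP] : exists q : branch_pair -> seq G, forall p, [/\ path (@adj G) (leaf p) (q p),
    last (leaf p) (q p) = leaf (swap_pair p), uniq (leaf p :: q p) & {subset leaf p :: q p <= Q p}].
  apply: (@fin_all_exists _ _ (fun p s => [/\ path (@adj G) (leaf p) s,
    last (leaf p) s = leaf (swap_pair p), uniq (leaf p :: s) & {subset leaf p :: s <= Q p}])) => p.
  by have /andP [? ?] := lQ p; apply: conn_path.
pose w (i j : 'I_t) : seq G :=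
  if insub (i, j) is Some p then leaf p :: q p else [::].
have wE (i j : 'I_t) : i < j -> exists p : branch_pair, val p = (i, j) /\ w i j = leaf p :: q p.
  move=> ij; have nij : (i, j).1 != (i, j).2 by rewrite neq_ltn ij.
  by exists (Sub (i, j) nij); rewrite /w insubT.
have cw (i j k : 'I_t) : i < j -> c k \notin w i j.
  move=> /wE [p [_ ->]]; have [_ _ _ sQ] := qP p; apply/negP => /sQ /(subsetP (QV p)).
  by apply/negP.
apply: (@subdivision_of_lt t G c w ci) => //.
- move=> i j ij; have := cw i j i ij; have := cw i j j ij; have [p [pij ->]] := wE i j ij.
  have [pq lq uq _] := qP p; have := cl p; have := cl (swap_pair p).
  rewrite /= pij /= => cj cii nj ni.
  apply/andP; split.
    rewrite rcons_path /= cii pq lq adjs cj //.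
  rewrite cons_uniq rcons_uniq mem_rcons inE negb_or ni nj uq !andbT.
  by apply: contraTneq ij => /ci ->; rewrite ltnn.
- move=> i j k l ij kl; have [p [pij ->]] := wE i j ij; have [p' [pkl ->]] := wE k l kl => ne.
  have [_ _ _ s1] := qP p; have [_ _ _ s2] := qP p'.
  apply/hasPn => v /s2 v2; apply/negP => /s1 v1.
  apply: (disjoint_in (dQ p p' _ _) v1 v2).
  + by apply: contraNneq ne => pp; rewrite -pij -pkl pp.
  + apply/eqP => pp; have := congr1 val pp; rewrite pkl /= pij => -[ki lj].
    by move: ij kl; rewrite ki lj /=; lia.
Qed.

(** Removing the t branch vertices costs at most t model sets, t in each degree and t in
    connectivity. This leaves 2 t^2 model sets, t^2 possible leaves at every branch vertex, and no
    separation of order below the number of leaves between the leaves and a model set. *)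
Lemma subdivision_of_connected (U : {set G}) (s g k : nat) :
  2 * t ^ 2 + t <= s -> t + t ^ 2 <= g -> t + t ^ 2 <= k -> 0 < #|U| ->
  (forall v, v \in U -> g < deg (@adj G) U v) ->
  (forall X Y a b, separation (@adj G) U X Y -> a \in X :\: Y -> b \in Y :\: X ->
    k < #|X :&: Y|) ->
  clique_model (@adj G) U s -> has_subdivision (complete_graph t) G.
Proof.
move=> ts tg tk U0 dU sepU [B [BU Bn Bc Bd Bt]].
have [u uU] : exists u, u \in U by apply/card_gt0P.
have tU : t <= #|U| by have := dU u uU; have := deg_le_card (@adj G) U u; lia.
have [c ci cU] : exists2 c : 'I_t -> G, injective c & forall i, c i \in U.
  by apply: (@distinct_representatives _ _ (fun _ => U)) => i; rewrite card_ord.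
pose C := c @: 'I_t; have cC : #|C| = t by rewrite card_imset // card_ord.
have CU : C \subset U by apply/subsetP => _ /imsetP [i _ ->].
have [leaf li lN] : exists2 leaf : branch_pair -> G, injective leaf &
    forall p, leaf p \in [set v in U :\: C | adj (c (val p).1) v].
  apply: distinct_representatives => p; apply: leq_trans card_branch_pair _.
  have := card_nbrs_diff (@adj G) U C (c (val p).1); have := dU _ (cU (val p).1); lia.
apply: (@subdivision_of_linkage (U :\: C) c leaf) => //.
- by move=> i; rewrite inE imset_f.
- by move=> p; have := lN p; rewrite inE => /andP [].
pose I : finType := {i : 'I_s | [disjoint B i & C]}.
have cI : s <= #|I| + t.
  rewrite -[X in X <= _]card_ord -(cardC [pred i | [disjoint B i & C]]) card_sig leq_add2l -cC.
  have [h hP] : exists h : 'I_s -> G,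
      forall i, ~~ [disjoint B i & C] -> (h i \in B i) && (h i \in C).
    apply: (@fin_all_exists _ _ (fun i a => ~~ [disjoint B i & C] -> (a \in B i) && (a \in C))) => i.
    have [_|/pred0Pn [a aP]] := boolP [disjoint B i & C]; [by exists u | by exists a].
  rewrite -(@card_in_imset _ _ h).
    by apply/subset_leq_card/subsetP => _ /imsetP [i /hP /andP [_ aC] ->].
  move=> i j /hP /andP [hi _] /hP /andP [hj _] hij; apply/eqP; apply: contraT => /Bd ij.
  by case: (disjoint_in ij hi); rewrite hij.
have BUC (i : I) : B (val i) \subset U :\: C by rewrite subsetD BU (valP i).
apply: (@hub_linked _ _ I _ _ _ (fun i => B (val i))) => //.
- exact: swap_pairK.
- by have := card_branch_pair; lia.
split=> //.
- by move=> p; have := lN p; rewrite inE => /andP [].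
- by move=> i j ij; apply: Bd.
- by left.
- by move=> i j ij; left; apply: Bt.
- move=> X Y i [XYV nXY] lX cXY; apply/exists_inP; apply: contraT => /exists_inPn h.
  have XYC x : x \in X :|: Y -> x \notin C by rewrite XYV inE => /andP [].
  have [X_C Y_C] : (forall x, x \in X -> x \notin C) /\ (forall x, x \in Y -> x \notin C).
    by split=> x xX; apply: XYC; rewrite inE xX ?orbT.
  have [b bB] := Bn (val i).
  have bX : b \notin X by apply/negP => /h; rewrite bB.
  have bY : b \in Y.
    by have := subsetP (BUC i) b bB; rewrite -XYV inE (negPf bX).
  have [p pY] : exists p, leaf p \notin Y.
    apply/existsP; apply: contraLR cXY => /existsPn lY; rewrite -leqNgt -(card_imset _ li).
    by apply/subset_leq_card/subsetP => _ /imsetP [p _ ->]; rewrite inE lX; have := lY p; rewrite negbK.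
  (* Adding C to both sides yields a separation of U, of order below t^2 + t <= k. *)
  have : k < #|(X :|: C) :&: (Y :|: C)|.
    apply: (sepU _ _ (leaf p) b).
    - split.
        by rewrite -setUUl XYV setDE setUIl [~: C :|: C]setUC setUCr setIT; apply/setUidPl.
      move=> x y; rewrite !inE !negb_or => /andP [/andP [xY xC] /orP [xX|xC']]; last by rewrite xC' in xC.
      case/andP=> /andP [yX yC] /orP [yY|yC']; last by rewrite yC' in yC.
      by apply: nXY; rewrite inE ?xX ?xY ?yX ?yY.
    - by rewrite !inE lX negb_or pY X_C.
    - by rewrite !inE bY negb_or bX Y_C.
  rewrite -setUIl => h2; have [+ _] := leq_card_setU (X :&: Y) C.
  by have := card_branch_pair; lia.
Qed.

(** With s = 2 t^2 + t, [dense_clique_model] needs 20 * 6 s^2 = 120 s^2 vertices, [dense_minor]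
    twice that as average degree, and Mader's argument halves the minimum degree. *)
Definition subdivision_degree : nat := 480 * (2 * t ^ 2 + t) ^ 2.

Theorem subdivision_of_min_degree (V : {set G}) : 0 < t -> 0 < #|V| ->
  (forall v, v \in V -> subdivision_degree <= deg (@adj G) V v) ->
  has_subdivision (complete_graph t) G.
Proof.
move=> t0 V0 dV; pose s := 2 * t ^ 2 + t; have s0 : 0 < s by rewrite /s; lia.
have ts : t + t ^ 2 <= s by rewrite /s; lia.
have [||||U UV [U0 dU sepU]] := @mader_connected _ _ V (240 * s ^ 2) s adjs adji; try lia.
- by nia.
- by move=> v /dV; rewrite /subdivision_degree -/s; lia.
apply: (@subdivision_of_connected U s (240 * s ^ 2) s) => //; first nia.
apply: (@dense_minor _ _ U (120 * s ^ 2)) => //.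
- by nia.
- have := arcs_le (fun v vU => ltnW (dU v vU)); lia.
move=> e' H es' ei' kH dH; apply: (@dense_clique_model _ e' es' H (6 * s ^ 2)) => //; nia.
Qed.
End Topological.

(** * Non-adjacent pairs among candidates *)

Section CliqueCount.
Variable G : sgraph.
Implicit Types (A B M S V W : {set G}).

Definition nbrs (v : G) : {set G} := [set w | adj v w].

Definition ncliques W : nat := #|[set A in cliques G | A \subset W]|.

Definition nonadj : rel G := [rel x y | (x != y) && ~~ adj x y].

Lemma nonadj_sym : symmetric nonadj.
Proof. by move=> x y; rewrite /nonadj /= eq_sym adj_sym. Qed.

Lemma nonadj_irr : irreflexive nonadj.
Proof. by move=> x; rewrite /nonadj /= eqxx. Qed.

Lemma cliquesP A : reflect {in A &, forall x y, x != y -> adj x y} (A \in cliques G).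
Proof.
rewrite inE; apply: (iffP forall_inP) => [h x y xA yA|h x xA].
  by have /forall_inP/(_ y yA)/implyP := h x xA.
by apply/forall_inP => y yA; apply/implyP; apply: h.
Qed.

Lemma clique_sub A B : A \subset B -> B \in cliques G -> A \in cliques G.
Proof.
by move=> /subsetP AB /cliquesP cB; apply/cliquesP => x y /AB xB /AB yB; apply: cB.
Qed.

Lemma ncliques_setT : ncliques setT = #|cliques G|.
Proof. by apply: eq_card => A; rewrite inE subsetT andbT. Qed.

Lemma ncliques_le W : ncliques W <= 2 ^ #|W|.
Proof.
rewrite -card_powerset; apply/subset_leq_card/subsetP => A.
by rewrite !inE => /andP [].
Qed.

Lemma ncliques_split W v : v \in W ->
  ncliques W <= ncliques (W :\ v) + ncliques (W :&: nbrs v).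
Proof.
move=> vW; rewrite /ncliques -(cardsID [set A : {set G} | v \notin A]); apply: leq_add.
  apply/subset_leq_card/subsetP => A; rewrite !inE => /andP [/andP [-> AW] vA] /=.
  by rewrite subsetD1 AW.
rewrite -(@card_in_imset _ _ (fun A => A :\ v)); last first.
  move=> A B; rewrite !inE !negbK => /andP [vA _] /andP [vB _] AB.
  by rewrite -(setD1K vA) AB setD1K.
apply/subset_leq_card/subsetP => _ /imsetP [A + ->].
case/setDP => /setIdP [cA AW]; rewrite inE negbK => vA; apply/setIdP; split.
  exact: clique_sub (subsetDl A [set v]) cA.
apply/subsetP => w /setD1P [wv wA]; rewrite !inE (subsetP AW) //=.
by move/cliquesP: cA; apply=> //; rewrite eq_sym.
Qed.

Lemma card_nbrs W v : v \in W -> #|W :&: nbrs v| + (deg nonadj W v).+1 = #|W|.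
Proof.
move=> vW; rewrite -(cardsID (nbrs v) W); congr (_ + _).
rewrite [RHS](cardsD1 v) !inE adj_irr vW /= add1n; congr _.+1; apply: eq_card => w.
by rewrite !inE /nonadj /= eq_sym; case: (w \in W); case: (w != v); case: (adj v w).
Qed.

(* Each non-adjacent pair of branch vertices is joined by its own common neighbour. *)
Lemma subdivision_of_common_nbrs (t : nat) V S (d : nat) : #|S| = t ->
  (forall v, v \in S -> #|V :\: nbrs v| <= d) ->
  arcs nonadj S + 2 * (t + 2 * d) <= 2 * #|V| -> has_subdivision (complete_graph t) G.
Proof.
move=> cS dS aS.
pose c (i : 'I_t) : G := enum_val (cast_ord (esym cS) i).
have ci : injective c by move=> i j /enum_val_inj /cast_ord_inj.
have cSi i : c i \in S by apply: enum_valP.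
pose K : finType := {p : 'I_t * 'I_t | (p.1 < p.2) && nonadj (c p.1) (c p.2)}.
have cK : 2 * #|K| <= arcs nonadj S.
  have -> : S = c @: 'I_t.
    apply/eqP; rewrite eq_sym eqEcard card_imset // card_ord cS leqnn andbT.
    by apply/subsetP => _ /imsetP [i _ ->].
  have ci' : {in 'I_t &, injective c} by move=> i j _ _; apply: ci.
  rewrite /arcs big_imset //=; under eq_bigr => i _ do rewrite degE big_imset //=.
  rewrite pair_big /= card_sig -sum1_card big_mkcond /= mul2n -addnn.
  rewrite {2}(reindex_inj (h := fun p : 'I_t * 'I_t => (p.2, p.1))) /=; last first.
    by move=> [i j] [i' j'] [-> ->].
  rewrite -big_split /=; apply: leq_sum => -[i j] _ /=; rewrite !inE /= [nonadj (c j) _]nonadj_sym.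
  by case: (ltngtP i j); case: (nonadj _ _).
(* Each pair has at least |V| - 2d - t common neighbours in V off S, hence at least |K| by [aS]. *)
have [f fi fN] : exists2 f : K -> G, injective f &
    forall p, f p \in (V :&: nbrs (c (val p).1) :&: nbrs (c (val p).2)) :\: S.
  apply: distinct_representatives => p.
  have := cardsID (nbrs (c (val p).1)) V; have := dS _ (cSi (val p).1).
  have := dS _ (cSi (val p).2); have := cardsID (nbrs (c (val p).2)) (V :&: nbrs (c (val p).1)).
  have : #|(V :&: nbrs (c (val p).1)) :\: nbrs (c (val p).2)| <= #|V :\: nbrs (c (val p).2)|.
    by apply/subset_leq_card/setSD/subsetIl.
  have := cardsID S (V :&: nbrs (c (val p).1) :&: nbrs (c (val p).2)).
  have : #|V :&: nbrs (c (val p).1) :&: nbrs (c (val p).2) :&: S| <= #|S|.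
    by apply/subset_leq_card/subsetIr.
  lia.
pose q (i j : 'I_t) : seq G := if insub (i, j) is Some p then [:: f (p : K)] else [::].
have qP (i j : 'I_t) : i < j -> (q i j = [::] /\ adj (c i) (c j)) \/
    exists p : K, [/\ val p = (i, j), q i j = [:: f p] & nonadj (c i) (c j)].
  move=> ij; rewrite /q; case: insubP => [p /andP [_ na] pij|]; first by right; exists p.
  rewrite /= ij /nonadj /= (inj_eq ci) => h; left; split=> //; move: h.
  by rewrite neq_ltn ij /= negbK.
apply: (@subdivision_of_lt t G c q ci).
- move=> i j ij; have nij : c i != c j by rewrite (inj_eq ci) neq_ltn ij.
  case: (qP i j ij) => [[-> aij]|[p [pij -> _]]].
    by rewrite /is_path /= aij inE nij.
  have := fN p; rewrite pij /= !inE => /andP [fS /andP [/andP [_ a1] a2]].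
  rewrite /is_path /= a1 [adj (f p) _]adj_sym a2 /= !inE negb_or nij andbT.
  rewrite andbT; apply/andP; split; apply: contraNneq fS => h.
    by rewrite -h cSi.
  by rewrite h cSi.
- move=> i j w ij; case: (qP i j ij) => [[-> _]|[p [pij -> _]]] //.
  by rewrite inE; apply: contraTneq (fN p) => <-; rewrite inE cSi.
- move=> i j k l ij kl ne; case: (qP i j ij) => [[-> _]|[p [pij -> _]]].
    by case: (q k l) => //= a s;
      rewrite -[X in ~~ X]/(has (mem [::]) (a :: s)) (eq_has (a2 := pred0)) ?has_pred0.
  case: (qP k l kl) => [[-> _]|[p' [pkl -> _]]] //=.
  rewrite orbF inE (inj_eq fi); apply: contraNneq ne => pp.
  by rewrite -pij -pkl pp.
Qed.

(** The density of non-adjacent pairs in M is the average of the densities in the sets M :\ v, since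
    each pair survives in all but two of them; descend until the size is t. *)
Lemma arcs_supersaturated (t a : nat) M : 1 < t ->
  (forall S, S \subset M -> #|S| = t -> a <= arcs nonadj S) -> t <= #|M| ->
  a * (#|M| * #|M|.-1) <= arcs nonadj M * (t * t.-1).
Proof.
move=> t1; move: {2}#|M| (erefl #|M|) => m; elim: m M => [|m IH] M cM hM tM; first by lia.
move: tM; rewrite leq_eqVlt => /orP [/eqP tM|tM].
  by rewrite -tM leq_mul // hM.
have h v : v \in M -> a * (m * m.-1) + 2 * (deg nonadj M v * (t * t.-1)) <= arcs nonadj M * (t * t.-1).
  move=> vM; have cMv : #|M :\ v| = m by have := cardsD1 v M; rewrite vM cM; lia.
  have := IH (M :\ v) cMv _ _; rewrite cMv (arcs_D1 nonadj_sym nonadj_irr vM) mulnDl => h.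
  rewrite -mulnA leq_add2r h //; last by lia.
  by move=> S SM; apply: hM; apply: subset_trans SM (subsetDl _ _).
have : \sum_(v in M) (a * (m * m.-1) + 2 * (deg nonadj M v * (t * t.-1))) <=
    \sum_(v in M) arcs nonadj M * (t * t.-1) by apply: leq_sum => v /h.
rewrite big_split /= !sum_nat_const -big_distrr -big_distrl /= -/(arcs nonadj M) cM.
set A := arcs _ _ * _ => h1.
(* The summed inequality amounts to a (m + 1) m (m - 1) <= (m - 1) A; the factor m - 1 cancels
   because m >= t >= 2. *)
have m0 : 0 < m.-1 by lia.
rewrite -(leq_pmul2r m0); case: m m0 {IH h cM tM} h1 => [|[|m]] //= _; nia.
Qed.

(** For m = |M|, the average non-degree is at least a (m - 1) / (t (t - 1)), and (m - 1) / (t - 1)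
    >= m / t as m >= t. *)
Lemma exists_high_nonadj (t a : nat) M : 1 < t ->
  (forall S, S \subset M -> #|S| = t -> a <= arcs nonadj S) -> t <= #|M| ->
  exists2 v, v \in M & a * #|M| <= deg nonadj M v * t ^ 2.
Proof.
move=> t1 hM tM; have sat := arcs_supersaturated t1 hM tM.
apply/exists_inP; apply: contraT => /exists_inPn h.
have : \sum_(v in M) (deg nonadj M v * t ^ 2).+1 <= \sum_(v in M) a * #|M|.
  by apply: leq_sum => v /h; rewrite -ltnNge.
under eq_bigr => v _ do rewrite -addn1.
rewrite big_split /= !sum_nat_const muln1 -big_distrl /= -/(arcs nonadj M).
move: sat tM; set A := arcs _ _; case: #|M| => [|m]; first lia.
case: t t1 {hM h} => [|[|t]] //= _; rewrite -mulnn => h1 h2 h3.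
have : a * m.+1 * m.+1 * t.+1 <= A * t.+2 * t.+2 * t.+1.
  have : a * m.+1 * m.+1 * t.+1 <= a * m.+1 * m * t.+2 by rewrite -!mulnA leq_mul // leq_mul //; nia.
  nia.
nia.
Qed.
End CliqueCount.

(** * Numerical estimates *)

Lemma bernoulli (m n : nat) : (m + n) * m ^ n <= m * m.+1 ^ n.
Proof.
elim: n => [|n IH]; first by rewrite !expn0; lia.
apply: (@leq_trans (m.+1 * ((m + n) * m ^ n))); last by rewrite [_.+1 ^ _.+1]expnS; nia.
by rewrite expnS; nia.
Qed.

(** (1 + 1/m)^m >= 2 by Bernoulli's inequality. With m = 999, fewer than 2^k vertices are exhausted
    by 999 k steps that each keep at most 999/1000 of them. *)
Lemma ltn_exp_ratio (m D k : nat) : 0 < m -> D < 2 ^ k ->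
  D * m ^ (m * k) < m.+1 ^ (m * k).
Proof.
move=> m0 Dk.
have b : 2 * m ^ m <= m.+1 ^ m.
  by rewrite -(leq_pmul2l m0); apply: leq_trans (bernoulli m m); rewrite addnn -mul2n mulnCA mulnA.
apply: (@leq_trans (2 ^ k * m ^ (m * k))).
  by rewrite ltn_pmul2r ?expn_gt0 ?m0.
by rewrite !expnM -expnMn; case: k {Dk} => // k; rewrite leq_exp2r.
Qed.

Lemma fourth_root (t : nat) : 0 < t ->
  exists u, [/\ 0 < u, t <= u ^ 4 & u ^ 4 <= 16 * t].
Proof.
move=> t0; have ex : exists u, t <= u ^ 4 by exists t; rewrite -[X in X <= _]expn1 leq_pexp2l.
case: (ex_minnP ex) => u tu umin; have u0 : 0 < u by case: u tu {umin} => //; rewrite exp0n //; lia.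
exists u; split=> //.
have lt : (u.-1) ^ 4 < t by rewrite ltnNge; apply/negP => /umin; lia.
case: u u0 lt {tu umin} => [//|[|u]] _ /= lt; first by rewrite exp1n; lia.
apply: (@leq_trans (16 * u.+1 ^ 4)); last by lia.
by rewrite -[16]/(2 ^ 4) -expnMn leq_exp2r //; lia.
Qed.

(** From u < 2^u follows t^4 <= u^16 <= 2^(16 u), and 480 * 9 < 2^13. *)
Lemma subdivision_degree_lt (t u : nat) : 0 < t -> t <= u ^ 4 ->
  subdivision_degree t < 2 ^ (13 + 16 * u).
Proof.
move=> t0 tu; have tu' : t ^ 4 <= 2 ^ (16 * u).
  apply: (@leq_trans ((u ^ 4) ^ 4)); first by rewrite leq_exp2r.
  have -> : 2 ^ (16 * u) = ((2 ^ u) ^ 4) ^ 4 by rewrite -!expnM; congr (_ ^ _); lia.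
  by rewrite !leq_exp2r // ltnW // ltn_expl.
have h : (2 * t ^ 2 + t) ^ 2 <= 9 * t ^ 4.
  have -> : 9 * t ^ 4 = (3 * t ^ 2) ^ 2 by rewrite expnMn -expnM.
  by rewrite leq_exp2r //; nia.
rewrite expnD; apply: (@leq_trans (2 ^ 13 * t ^ 4)); last by rewrite leq_mul2l tu' orbT.
have t4 : 0 < t ^ 4 by rewrite expn_gt0 t0.
apply: (@leq_trans (2 ^ 4 * (2 ^ 9 * t ^ 4))); last by rewrite mulnA -expnD.
rewrite /subdivision_degree; apply: (@leq_trans (480 * (9 * t ^ 4) + t ^ 4)); first by nia.
by lia.
Qed.

Lemma subdivision1 (G : sgraph) : 0 < #|G| -> has_subdivision (complete_graph 1) G.
Proof.
move=> /card_gt0P [v _].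
apply: (@subdivision_of_lt 1 G (fun _ => v) (fun _ _ => [::])).
- by move=> i j _; rewrite !ord1.
- by move=> i j; rewrite !ord1.
- by [].
- by [].
Qed.

From mathcomp Require Import all_classical all_reals all_analysis.

Import Order.TTheory GRing.Theory Num.Theory.
Import numFieldNormedType.Exports.
Local Open Scope ring_scope.

(** * The weight function of the branching recursion *)

Section Weights.
Variable R : realType.
Implicit Types (x d q r : R).

(** exp (q/4) >= 1 + q/4, and (1 + q/4)^2 exceeds q by (1 - q/4)^2; take the fourth power. *)
Lemma expR_ge_sqr q : 0 <= q -> q ^+ 2 <= expR q.
Proof.
move=> q0; have h : 1 + q / 4 <= expR (q / 4) by apply: expR_ge1Dx.
have -> : expR q = expR (q / 4) ^+ 4 by rewrite -expRM_natl; congr expR; field.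
apply: (@le_trans _ _ ((1 + q / 4) ^+ 4)); last by rewrite lerXn2r ?nnegrE ?expR_ge0 //; lra.
have h1 : q <= (1 + q / 4) ^+ 2.
  have -> : (1 + q / 4) ^+ 2 = q + (1 - q / 4) ^+ 2 by field.
  by rewrite lerDl sqr_ge0.
have -> : (1 + q / 4) ^+ 4 = ((1 + q / 4) ^+ 2) ^+ 2 by rewrite -exprM.
by rewrite lerXn2r ?nnegrE //; apply: le_trans h1.
Qed.

(* Any w with exp (-w) + exp (-(1 + x) w) <= 1 bounds the growth of the logarithm of the
   number of cliques when branching on a vertex with x non-neighbours; this choice has
   explicit sums. *)
Definition weight x : R := Num.min (ln 2) (x `^ (- (2 / 3))).

Lemma weight_le_ln2 x : weight x <= ln 2.
Proof. by rewrite /weight ge_min lexx. Qed.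

Lemma ln2_gt0 : 0 < ln 2 :> R.
Proof. by rewrite ln_gt0 // ltr1n. Qed.

Lemma weight_anti x y : 0 < x -> x <= y -> weight y <= weight x.
Proof.
move=> x0 xy; rewrite /weight le_min ge_min lexx /= ge_min; apply/orP; right.
have y0 : 0 < y by apply: lt_le_trans xy.
rewrite !powRN lef_pV2 ?posrE ?powR_gt0 //.
by apply: ge0_ler_powR => //; rewrite ?nnegrE ?(ltW x0) ?(ltW y0) //; lra.
Qed.

(* With q = x^(1/3), the weight is at most q^-2 and x q^-2 = q, so the inequality reduces
   to exp q >= q^2. *)
Lemma weight_split x d : 0 < x -> x <= d ->
  expR (- weight x) + expR (- ((1 + d) * weight x)) <= 1.
Proof.
move=> x0 xd; have d0 : 0 < d by apply: lt_le_trans xd.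
have [le|gt] := leP (ln 2 : R) (x `^ (- (2 / 3))).
  have -> : weight x = ln 2 by rewrite /weight; apply/min_idPl.
  have e2 : expR (- ln 2) = 2^-1 :> R by rewrite expRN lnK // posrE.
  have : expR (- ((1 + d) * ln 2)) <= 2^-1.
    by rewrite -e2 ler_expR lerN2; have := ln2_gt0; nra.
  by rewrite e2; lra.
have -> : weight x = x `^ (- (2 / 3)) by rewrite /weight; apply/min_idPr/ltW.
set q := x `^ (3^-1); have q0 : 0 < q by apply: powR_gt0.
have qx : q ^+ 3 = x by rewrite /q -powR_mulrn ?powR_ge0 // -powRrM mulVf ?powRr1 ?ltW.
set y := x `^ _; have yq : y = (q ^+ 2)^-1.
  by rewrite /y /q -powR_mulrn ?powR_ge0 // -powRrM powRN; congr (_ `^ _)^-1; field.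
have y0 : 0 < y by rewrite yq invr_gt0 exprn_gt0.
have xy : x * y = q by rewrite yq -qx; field; rewrite gt_eqF.
have -> : expR (- ((1 + d) * y)) = expR (- y) * expR (- (d * y)).
  by rewrite -expRD; congr expR; ring.
have h1 : expR (- (d * y)) <= y.
  apply: (@le_trans _ _ (expR (- q))).
    by rewrite ler_expR lerN2 -xy ler_wpM2r // ltW.
  by rewrite expRN yq lef_pV2 ?posrE ?expR_gt0 ?exprn_gt0 // expR_ge_sqr // ltW.
have h2 : expR (- y) * (1 + y) <= 1.
  rewrite expRN mulrC ler_pdivrMr ?expR_gt0 // mul1r; exact: expR_ge1Dx.
have : expR (- y) * expR (- (d * y)) <= expR (- y) * y by rewrite ler_wpM2l ?expR_ge0.
by lra.
Qed.

(** This compares a term with the integral of x^(-2/3), done algebraically: for the two cube roots a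
    and b, 3 (a - b) a^2 exceeds a^3 - b^3 = 1 by (a - b)^2 (2a + b). *)
Lemma cube_root_step (n : nat) :
  n.+1%:R `^ (- (2 / 3)) <= 3 * (n.+1%:R `^ (3^-1) - n%:R `^ (3^-1)) :> R.
Proof.
set a : R := n.+1%:R `^ (3^-1); set b : R := n%:R `^ (3^-1); set c := _ `^ _.
have a0 : 0 < a by apply: powR_gt0; rewrite ltr0n.
have b0 : 0 <= b by apply: powR_ge0.
have cube (x : R) : 0 <= x -> (x `^ (3^-1)) ^+ 3 = x.
  by move=> x0; rewrite -powR_mulrn ?powR_ge0 // -powRrM mulVf ?powRr1.
have ab : a ^+ 3 - b ^+ 3 = 1 by rewrite /a /b !cube ?ler0n // -[n.+1]addn1 natrD addrAC subrr add0r.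
have ba : b <= a.
  by rewrite /a /b; apply: ge0_ler_powR; rewrite ?nnegrE ?ler_nat //; lra.
have ca : c = (a ^+ 2)^-1.
  by rewrite /c /a -powR_mulrn ?powR_ge0 // -powRrM powRN; congr (_ `^ _)^-1; field.
rewrite ca -[X in X <= _]mul1r ler_pdivrMr ?exprn_gt0 //.
have -> : 3 * (a - b) * a ^+ 2 = (a ^+ 3 - b ^+ 3) + (a - b) ^+ 2 * (2 * a + b) by ring.
by rewrite ab lerDl mulr_ge0 ?sqr_ge0 // addr_ge0 // mulr_ge0 // ltW.
Qed.

Lemma weight_sum (t m : nat) r : 0 < r ->
  \sum_(j < t + m) (if (j < t)%N then ln 2 else weight (r * j.+1%:R)) <=
  t%:R * ln 2 + 3 * r `^ (- (2 / 3)) * ((t + m)%:R `^ (3^-1) - t%:R `^ (3^-1)).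
Proof.
move=> r0; elim: m => [|m IH].
  rewrite addn0 subrr mulr0 addr0 (eq_bigr (fun _ => ln 2)).
    by rewrite sumr_const card_ord mulr_natl.
  by move=> j _; rewrite ltn_ord.
rewrite addnS big_ord_recr /=; have -> : (t + m < t)%N = false by lia.
have : weight (r * (t + m).+1%:R) <=
    3 * r `^ (- (2 / 3)) * ((t + m).+1%:R `^ (3^-1) - (t + m)%:R `^ (3^-1)).
  rewrite /weight ge_min; apply/orP; right.
  rewrite powRM ?ler0n ?(ltW r0) // -mulrA mulrCA ler_wpM2l ?powR_ge0 //.
  exact: cube_root_step.
by move: IH; set A := \sum_(_ < _) _; lra.
Qed.
End Weights.

(** * Counting cliques *)

Section Local.
Variables (R : realType) (G : sgraph).

Lemma expR_ln2 (n : nat) : expR (n%:R * ln 2) = 2 ^+ n :> R.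
Proof. by rewrite expRM_natl lnK // posrE. Qed.

Lemma ncliques_le_expR (M : {set G}) : (ncliques M)%:R <= expR (#|M|%:R * ln 2) :> R.
Proof. by rewrite expR_ln2 -natrX ler_nat ncliques_le. Qed.

(** Branching on v leaves sets of |M| - 1 and |M| - d - 1 vertices. Every summand is at least
    [weight (r * |M|)], so the exponent drops by at least one and 1 + d times this weight, and
    [weight_split] closes the recursion. *)
Lemma ncliques_weight (t : nat) (r : R) (M : {set G}) : 0 < r ->
  (forall M' : {set G}, M' \subset M -> (t < #|M'|)%N ->
     exists2 v, v \in M' & r * #|M'|%:R <= (deg (@nonadj G) M' v)%:R) ->
  (ncliques M)%:R <=
    expR (\sum_(j < #|M|) (if (j < t)%N then ln 2 else weight (r * j.+1%:R))).
Proof.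
move=> r0; pose wt j : R := if (j < t)%N then ln 2 else weight (r * j.+1%:R).
rewrite -/wt; move: {2}#|M|.+1 (ltnSn #|M|) => n; elim: n M => // n IH M Mn hM.
have [Mt|tM] := leqP #|M| t.
  rewrite (eq_bigr (fun _ => ln 2)) => [|j _].
    by rewrite sumr_const card_ord -[ln 2 *+ _]mulr_natl ncliques_le_expR.
  by rewrite (leq_trans (ltn_ord j) Mt).
have [v vM dv] := hM M (subxx M) tM.
set d := deg _ _ _ in dv; have c1 := card_nbrs vM; rewrite -/d in c1.
have c2 := cardsD1 v M; rewrite vM /= in c2.
have hsub (M' : {set G}) : M' \subset M -> (#|M'| < #|M|)%N ->
    (ncliques M')%:R <= expR (\sum_(j < #|M'|) wt j).
  move=> sM lM; apply: IH; first by apply: leq_trans lM _; rewrite -ltnS.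
  by move=> M'' sM'; apply: hM; apply: (fintype.subset_trans sM' sM).
set S := fun k => \sum_(j < k) wt j.
have wtle j : (j < #|M|)%N -> weight (r * #|M|%:R) <= wt j.
  move=> jM; rewrite /wt; case: ifP => _; first exact: weight_le_ln2.
  by apply: weight_anti; rewrite ?mulr_gt0 ?ltr0n // ler_pM2l // ler_nat.
have Sstep k : (k <= #|M|)%N -> S (#|M| - k)%N + k%:R * weight (r * #|M|%:R) <= S #|M|.
  elim: k => [|k IHk] kM; first by rewrite subn0 mul0r addr0.
  apply: le_trans (IHk (ltnW kM)).
  have -> : (#|M| - k = (#|M| - k.+1).+1)%N by lia.
  have -> : S (#|M| - k.+1).+1 = S (#|M| - k.+1)%N + wt (#|M| - k.+1)%N.
    by rewrite /S big_ord_recr.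
  have h : weight (r * #|M|%:R) <= wt (#|M| - k.+1)%N by apply: wtle; lia.
  by rewrite -[k.+1%:R]natr1 mulrDl mul1r; lra.
have hA : (ncliques (M :\ v))%:R <= expR (S #|M|) * expR (- weight (r * #|M|%:R)).
  rewrite -expRD; apply: le_trans (hsub _ (subsetDl _ _) _) _; first lia.
  rewrite ler_expR lerBrDr; have := Sstep 1%N; rewrite mul1r.
  have -> : #|M :\ v| = (#|M| - 1)%N by lia.
  by apply; lia.
have hB : (ncliques (M :&: nbrs v))%:R <=
    expR (S #|M|) * expR (- ((1 + d%:R) * weight (r * #|M|%:R))).
  rewrite -expRD; apply: le_trans (hsub _ (subsetIl _ _) _) _; first lia.
  rewrite ler_expR lerBrDr; have := Sstep d.+1; rewrite -[d.+1%:R]natr1 [d%:R + 1]addrC.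
  have -> : #|M :&: nbrs v| = (#|M| - d.+1)%N by lia.
  by apply; lia.
have M0 : 0 < #|M|%:R :> R by rewrite ltr0n; lia.
have hs := weight_split (mulr_gt0 r0 M0) dv.
have h : (ncliques M)%:R <= (ncliques (M :\ v))%:R + (ncliques (M :&: nbrs v))%:R :> R.
  by rewrite -natrD ler_nat ncliques_split.
apply: (le_trans h); apply: (le_trans (lerD hA hB)).
by rewrite -mulrDr -[X in _ <= X]mulr1 ler_pM2l ?expR_gt0.
Qed.

(** exp (-2/3) is the 16th power of exp (-1/24) >= 23/24, and (23/24)^16 >= 1/2. *)
Lemma ln2_ge : 2 / 3 <= ln 2 :> R.
Proof.
rewrite -ler_expR lnK ?posrE //.
have -> : expR (2 / 3) = (expR (- (1 / 24)) ^+ 16)^-1 :> R.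
  by rewrite -expRM_natl -expRN; congr expR; field.
have h : 23 / 24 <= expR (- (1 / 24)) :> R by apply: le_trans (expR_ge1Dx _); lra.
rewrite -[X in _ <= X]invrK lef_pV2 ?posrE ?invr_gt0 ?exprn_gt0 ?expR_gt0 //.
apply: (@le_trans _ _ ((23 / 24) ^+ 16)); last by rewrite lerXn2r ?nnegrE ?expR_ge0 //; lra.
by lra.
Qed.

(* With w = a^2 + a b + b^2, the quotient (a - b) b^3 / w^2 is largest for a/b the golden
   ratio, where w is about 5.2 b^2; hence the tangent bound 10.4 w b^2 - 5.2^2 b^4 <= w^2. *)
Lemma cubic_bound (a b : R) : 0 <= a -> 0 <= b ->
  43 * (a - b) * b ^+ 3 <= (a ^+ 2 + a * b + b ^+ 2) ^+ 2.
Proof.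
move=> a0 b0; pose w := a ^+ 2 + a * b + b ^+ 2.
have h1 : 43 * ((a - b) * b) <= 104 / 10 * w - 2704 / 100 * b ^+ 2.
  have s1 := sqr_ge0 (a - 157 / 100 * b); have s2 := sqr_ge0 b; have s3 := mulr_ge0 a0 b0.
  by rewrite /w; nra.
have h2 : (104 / 10 * w - 2704 / 100 * b ^+ 2) * b ^+ 2 <= w ^+ 2.
  by have s := sqr_ge0 (w - 52 / 10 * b ^+ 2); nra.
apply: le_trans h2; have -> : 43 * (a - b) * b ^+ 3 = 43 * ((a - b) * b) * b ^+ 2 by ring.
by rewrite ler_wpM2r // sqr_ge0.
Qed.

(** Cubed and multiplied by b^3, the left side is 27/43 (a - b)^2 times that of [cubic_bound], so at
    most 27/43 ((a - b) w)^2 with w = a^2 + ab + b^2; and (a - b) w = a^3 - b^3. *)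
Lemma cube_root_bound (K c a b q : R) : 0 <= K -> 0 <= c -> 27 / 43 <= K ^+ 3 * c ^+ 2 ->
  0 < b -> b < a -> 0 < q -> c * (a ^+ 3 - b ^+ 3) <= q ^+ 3 * b ^+ 6 ->
  3 * (a - b) <= K * b ^+ 3 * q ^+ 2.
Proof.
move=> K0 c0 Kc b0 ab q0 hq.
have a0 : 0 < a by apply: lt_trans ab.
have d0 : 0 <= a - b by rewrite subr_ge0 ltW.
have L0 : 0 <= 3 * (a - b) by apply: mulr_ge0 d0; apply: ler0n.
have B0 : 0 <= b ^+ 3 by apply/exprn_ge0/ltW.
have U0 : 0 <= K * b ^+ 3 * q ^+ 2 by apply: mulr_ge0 (sqr_ge0 q); apply: mulr_ge0.
rewrite -(ler_pXn2r (isT : (0 < 3)%N) L0 U0).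
have b3p : 0 < b ^+ 3 by apply: exprn_gt0.
rewrite -(ler_pM2r b3p).
have key := cubic_bound (ltW a0) (ltW b0).
pose w := a ^+ 2 + a * b + b ^+ 2.
have -> : (3 * (a - b)) ^+ 3 * b ^+ 3 = (27 / 43 * (a - b) ^+ 2) * (43 * (a - b) * b ^+ 3).
  by field.
have -> : (K * b ^+ 3 * q ^+ 2) ^+ 3 * b ^+ 3 = K ^+ 3 * (q ^+ 3 * b ^+ 6) ^+ 2 by ring.
have C0 : 0 <= c * (a ^+ 3 - b ^+ 3).
  have -> : a ^+ 3 - b ^+ 3 = (a - b) * w by rewrite /w; ring.
  apply: mulr_ge0 => //; apply: mulr_ge0 => //.
  rewrite /w; apply: addr_ge0; last exact: sqr_ge0.
  by apply: addr_ge0; [apply: sqr_ge0 | apply: mulr_ge0; apply: ltW].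
have sq : (c * (a ^+ 3 - b ^+ 3)) ^+ 2 <= (q ^+ 3 * b ^+ 6) ^+ 2.
  by rewrite (ler_pXn2r (isT : (0 < 2)%N) C0 (le_trans C0 hq)).
apply: le_trans (ler_wpM2l (exprn_ge0 3 K0) sq).
have -> : K ^+ 3 * (c * (a ^+ 3 - b ^+ 3)) ^+ 2 = (K ^+ 3 * c ^+ 2) * (a - b) ^+ 2 * w ^+ 2.
  by rewrite /w; ring.
have m0 : 0 <= 27 / 43 * (a - b) ^+ 2.
  by apply: mulr_ge0 (sqr_ge0 _); apply: divr_ge0; apply: ler0n.
apply: le_trans (ler_wpM2l m0 key) _; apply: ler_wpM2r (sqr_ge0 _) _ _ _.
exact: ler_wpM2r (sqr_ge0 _) _ _ Kc.
Qed.

Lemma powR_cube_root (x : R) : 0 < x -> (x `^ (3^-1)) ^+ 3 = x.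
Proof.
by move=> x0; rewrite -powR_mulrn ?powR_ge0 // -powRrM mulVf ?powRr1 // ltW.
Qed.

Lemma weight_total (T N r : R) : 0 < T -> 9 / 5 * T <= N ->
  2 * (998 / 1000 * N - T) <= r * T ^+ 2 ->
  3 * r `^ (- (2 / 3)) * (N `^ (3^-1) - T `^ (3^-1)) <= 817 / 1000 * T * ln 2.
Proof.
move=> T0 TN hr.
have T2 : 0 < T ^+ 2 by apply: exprn_gt0.
have r0 : 0 < r by rewrite -(pmulr_lgt0 _ T2); apply: lt_le_trans hr; lra.
have N0 : 0 < N by lra.
have T_N : T < N by lra.
have -> : r `^ (- (2 / 3)) = ((r `^ (3^-1)) ^+ 2)^-1.
  by rewrite -powR_mulrn ?powR_ge0 // -powRrM powRN; congr (_ `^ _)^-1; field.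
have : 0 < r `^ (3^-1) by apply: powR_gt0.
have : 0 < T `^ (3^-1) by apply: powR_gt0.
have : T `^ (3^-1) < N `^ (3^-1).
  by apply: gt0_ltr_powR (ltW T0) (ltW N0) T_N; rewrite invr_gt0 ltr0n.
have := powR_cube_root N0; have := powR_cube_root T0; have := powR_cube_root r0.
move: (N `^ _) (T `^ _) (r `^ _) => a b q q3 b3 a3 ab b0 q0.
(* N >= 9/5 T gives 998/1000 N - T >= 9955/10000 (N - T). The factor 2/3 stands in for ln 2; then
   K^3 c^2 is about 0.64, above 27/43. *)
have h : 3 * (a - b) <= 817 / 1000 * (2 / 3) * b ^+ 3 * q ^+ 2.
  apply: (@cube_root_bound _ (2 * (9955 / 10000)) a b q _ _ _ b0 ab q0); [by lra.. |].
  have -> : b ^+ 6 = T ^+ 2 by rewrite -b3 -exprM.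
  by rewrite a3 b3 q3; lra.
rewrite mulrAC ler_pdivrMr ?exprn_gt0 //; apply: le_trans h _.
rewrite b3; apply: ler_wpM2r (sqr_ge0 q) _ _ _.
have l2 := ln2_ge; have : 817 / 1000 * T * (2 / 3) <= 817 / 1000 * T * ln 2.
  by apply: ler_wpM2l l2; lra.
by lra.
Qed.
End Local.

Section Global.
Variables (R : realType) (G : sgraph).

Lemma powR2E (x : R) : 2 `^ x = expR (x * ln 2).
Proof. by rewrite /powR pnatr_eq0. Qed.

Lemma ncliques_dense (t : nat) (V M : {set G}) : (1 < t)%N ->
  ~ has_subdivision (complete_graph t) G -> M \subset V ->
  (forall v, v \in M -> 1000 * #|V :\: nbrs v| < #|V|)%N ->
  (ncliques M)%:R <= 2 `^ (1817 / 1000 * t%:R) :> R.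
Proof.
move=> t1 nT MV dV; rewrite powR2E.
have l0 := ln2_gt0 R; have T0 : 0 < t%:R :> R by rewrite ltr0n; lia.
have cMV : (#|M| <= #|V|)%N by apply: subset_leq_card.
have small (x : R) : #|M|%:R <= x -> (ncliques M)%:R <= expR (x * ln 2).
  move=> Mx; apply: le_trans (ncliques_le_expR R M) _; rewrite ler_expR.
  exact: ler_wpM2r (ltW l0) _ _ Mx.
have [Mt|tM] := leqP #|M| t.
  apply: small; have : #|M|%:R <= t%:R :> R by rewrite ler_nat.
  lra.
have [Vt|tV] := leqP (5 * #|V|) (9 * t).
  apply: small; have : (5 * #|M|)%:R <= (9 * t)%:R :> R by rewrite ler_nat; lia.
  by rewrite !natrM; lra.
(* If [arcs] were at most 2 (|V| - t - 2d) on some t candidates, these would be branch vertices of a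
   K_t-subdivision; a is one more. Then r |M'| bounds the largest non-degree in M' from below. *)
pose d := (#|V| %/ 1000)%N; pose a := (2 * (#|V| - t - 2 * d)).+1.
pose r : R := a%:R / t%:R ^+ 2.
have dVd v : v \in M -> (#|V :\: nbrs v| <= d)%N by move=> /dV h; rewrite /d; lia.
have aS (S : {set G}) : S \subset M -> #|S| = t -> (a <= arcs (@nonadj G) S)%N.
  move=> SM St; rewrite leqNgt; apply/negP => aS; apply: nT.
  apply: (@subdivision_of_common_nbrs G t V S d) => //.
    by move=> v /(fintype.subsetP SM); apply: dVd.
  by move: aS; rewrite /a /d; lia.
have t2 : 0 < t%:R ^+ 2 :> R by apply: exprn_gt0.
have r0 : 0 < r by apply: divr_gt0 t2; rewrite ltr0n.
have := @ncliques_weight R G t r M r0 _.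
move=> h; apply: le_trans (h _) _ => {h}.
  move=> M' M'M tM'.
  have [|v vM hv] := @exists_high_nonadj G t a M' t1 _ (ltnW tM').
    by move=> S SM'; apply: aS; apply: fintype.subset_trans SM' M'M.
  exists v => //; rewrite /r mulrAC ler_pdivrMr // -natrX -!natrM ler_nat.
  exact: hv.
rewrite ler_expR.
have [m Mm] : exists m, #|M| = (t + m)%N by exists (#|M| - t)%N; lia.
rewrite Mm; apply: le_trans (weight_sum t m r0) _; rewrite -Mm.
have tot : 3 * r `^ (- (2 / 3)) * (#|V|%:R `^ (3^-1) - t%:R `^ (3^-1)) <= 817 / 1000 * t%:R * ln 2.
  apply: weight_total => //.
    have : (9 * t)%:R <= (5 * #|V|)%:R :> R by rewrite ler_nat; lia.
    by rewrite !natrM; lra.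
  rewrite /r mulfVK ?gt_eqF //.
  have : (2 * 998 * #|V|)%:R <= (1000 * (a + 2 * t))%:R :> R.
    by rewrite ler_nat /a /d; lia.
  by rewrite !(natrM, natrD); lra.
have mono : #|M|%:R `^ (3^-1) <= #|V|%:R `^ (3^-1) :> R.
  by apply: ge0_ler_powR; rewrite ?nnegrE ?ler0n ?ler_nat // invr_ge0 ler0n.
have p0 : 0 <= 3 * r `^ (- (2 / 3)) by apply: mulr_ge0 (powR_ge0 _ _); apply: ler0n.
have step : 3 * r `^ (- (2 / 3)) * (#|M|%:R `^ (3^-1) - t%:R `^ (3^-1)) <=
   3 * r `^ (- (2 / 3)) * (#|V|%:R `^ (3^-1) - t%:R `^ (3^-1)).
  by apply: ler_wpM2l p0 _ _ _; rewrite lerD2r.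
have := le_trans step tot.
set X := 3 * _ * _; lra.
Qed.

(** The exponent i bounds how often V can still shrink. Excluding v removes it from M and keeps V
    and i; including v shrinks V by a thousandth and lowers i. The recursion closes by m^(i+1) + m^i
    <= (m + 1)^(i+1). *)
Lemma ncliques_peel (C : R) : 1 <= C ->
  (forall V M : {set G}, M \subset V ->
     (forall v, v \in M -> 1000 * #|V :\: nbrs v| < #|V|)%N -> (ncliques M)%:R <= C) ->
  forall i (V M : {set G}), M \subset V -> (#|V| * 999 ^ i < 1000 ^ i)%N ->
  (ncliques M)%:R <= C * #|M|.+1%:R ^+ i.
Proof.
move=> C1 term i V M; have C0 : 0 <= C by apply: le_trans C1.
move: {2}#|M|.+1 (ltnSn #|M|) => n; elim: n i V M => // n IH i V M Mn MV Vi.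
have [/exists_inP [v vM hv]|h] :=
  boolP [exists v in M, (#|V| <= 1000 * #|V :\: nbrs v|)%N]; last first.
  apply: (@le_trans _ _ C).
    apply: (term V) => // v vM; rewrite ltnNge; apply: contra h => h.
    by apply/exists_inP; exists v.
  by rewrite ler_peMr // exprn_ege1 // ler1n.
have vV := fintype.subsetP MV _ vM.
have V0 : (0 < #|V|)%N by apply/card_gt0P; exists v.
case: i Vi => [|i] Vi; first by move: Vi; rewrite !expn0; lia.
have cV := cardsID (nbrs v) V.
have hA : (ncliques (M :\ v))%:R <= C * #|M|%:R ^+ i.+1.
  have cM := cardsD1 v M; rewrite vM /= add1n in cM.
  rewrite cM; apply: (IH i.+1 V) => //; first lia.
  by apply: fintype.subset_trans MV; apply: finset.subsetDl.
have hB : (ncliques (M :&: nbrs v))%:R <= C * #|M|%:R ^+ i.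
  have cM := card_nbrs vM.
  have h : (ncliques (M :&: nbrs v))%:R <= C * #|M :&: nbrs v|.+1%:R ^+ i.
    apply: (IH i (V :&: nbrs v)); first lia; first exact: finset.setSI.
    move: Vi; rewrite !expnS; nia.
  apply: le_trans h _; apply: ler_wpM2l C0 _ _ _.
  by apply: lerXn2r; rewrite ?nnegrE ?ler0n // ler_nat; lia.
have h : (ncliques M)%:R <= (ncliques (M :\ v))%:R + (ncliques (M :&: nbrs v))%:R :> R.
  by rewrite -natrD ler_nat ncliques_split.
apply: le_trans h _; apply: le_trans (lerD hA hB) _.
rewrite -mulrDr; apply: ler_wpM2l C0 _ _ _; rewrite -!natrX -natrD ler_nat.
have : (#|M| ^ i <= #|M|.+1 ^ i)%N by case: (i) => // j; rewrite leq_exp2r.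
by rewrite !expnS; nia.
Qed.

(** The 1 is the empty clique; any other clique is charged to its first vertex in a degeneracy
    order, which has at most D later neighbours. *)
Lemma ncliques_degenerate (D : nat) (F : R) :
  (forall W : {set G}, (0 < #|W|)%N -> exists2 v, v \in W & (deg (@adj G) W v <= D)%N) ->
  (forall W : {set G}, (#|W| <= D)%N -> (ncliques W)%:R <= F) ->
  forall W : {set G}, (ncliques W)%:R <= 1 + #|W|%:R * F.
Proof.
move=> hD hF W; move: {2}#|W| (erefl #|W|) => n; elim: n W => [|n IH] W Wn.
  by rewrite Wn mul0r addr0 lern1; have := ncliques_le W; rewrite Wn.
have [|v vW dv] := hD W; first by rewrite Wn.
have cW : #|W :\ v| = n by have := cardsD1 v W; rewrite vW Wn add1n => -[].
have h : (ncliques W)%:R <= (ncliques (W :\ v))%:R + (ncliques (W :&: nbrs v))%:R :> R.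
  by rewrite -natrD ler_nat ncliques_split.
apply: le_trans h _; have h1 := IH _ cW.
have h2 : (ncliques (W :&: nbrs v))%:R <= F.
  apply: hF; apply: leq_trans dv; apply/subset_leq_card/fintype.subsetP => w.
  by rewrite !inE.
by rewrite Wn -natr1 mulrDl mul1r addrA; move: h1; rewrite cW => h1; apply: lerD.
Qed.
End Global.

Section Bound.
Variables (R : realType).

(* If t <= u^4, then 13 + 16 u bounds the binary logarithm of the degeneracy, and the
   least such u satisfies u^2 = O(sqrt t). *)
Definition cliques_eps (t : nat) : R := 1000 * 29 ^+ 2 * 8 * Num.sqrt (harmonic t).

(** 13 + 16 u <= 29 u gives the factor 1000 * 29^2. The 8 covers u^2 <= 4 sqrt t together with the
    loss of at most sqrt 2 from [harmonic t] = 1/(t + 1). *)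
Lemma cliques_eps_ge (t u : nat) : (0 < t)%N -> (0 < u)%N -> (u ^ 4 <= 16 * t)%N ->
  (1 + 999 * (13 + 16 * u) ^ 2)%N%:R <= cliques_eps t * t%:R :> R.
Proof.
move=> t0 u0 ut.
apply: (@le_trans _ _ (1000 * 29 ^+ 2 * (u ^ 2)%:R)).
  by rewrite -natrX -!natrM ler_nat; nia.
have X0 : 0 <= 1000 * 29 ^+ 2 :> R.
  by apply: mulr_ge0; [apply: ler0n | apply/exprn_ge0/ler0n].
have -> : cliques_eps t * t%:R = 1000 * 29 ^+ 2 * (8 * (Num.sqrt (harmonic t) * t%:R)).
  by rewrite /cliques_eps !mulrA.
apply: ler_wpM2l X0 _ _ _.
have -> : (u ^ 2)%:R = Num.sqrt ((u ^ 4)%:R) :> R.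
  have -> : (u ^ 4)%:R = (u ^ 2)%:R ^+ 2 :> R by rewrite -natrX -expnM.
  by rewrite sqrtr_sqr ger0_norm ?ler0n.
have -> : 8 * (Num.sqrt (harmonic t) * t%:R) = Num.sqrt (harmonic t * (8 * t%:R) ^+ 2) :> R.
  rewrite sqrtrM ?invr_ge0 ?ler0n // sqrtr_sqr ger0_norm; first by ring.
  by rewrite -natrM ler0n.
rewrite ler_sqrt; last by apply: mulr_ge0 (sqr_ge0 _); rewrite invr_ge0 ler0n.
rewrite /harmonic /= mulrC ler_pdivlMr ?ltr0n // -natrM -natrX -natrM ler_nat; nia.
Qed.

Lemma cliques_eps_cvg : (cliques_eps t @[t --> \oo] --> (0 : R))%classic.
Proof.
rewrite -[X in (_ --> X)%classic](mulr0 (1000 * 29 ^+ 2 * 8 : R)); apply: cvgMr.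
rewrite -[X in (_ --> X)%classic]sqrtr0.
by apply: continuous_cvg; [apply: sqrt_continuous | apply: cvg_harmonic].
Qed.

Lemma card_cliques_le (t : nat) (G : sgraph) : (1 < t)%N -> (0 < #|G|)%N ->
  ~ has_subdivision (complete_graph t) G ->
  #|cliques G|%:R <= 2 `^ (1817 / 1000 * t%:R + cliques_eps t * t%:R) * #|G|%:R :> R.
Proof.
move=> t1 G0 nT; have [u [u0 tu ut]] := fourth_root (ltnW t1).
set k := (13 + 16 * u)%N; have Dk := subdivision_degree_lt (ltnW t1) tu; rewrite -/k in Dk.
set D := subdivision_degree t in Dk.
pose C : R := 2 `^ (1817 / 1000 * t%:R).
have C1 : 1 <= C.
  rewrite /C powR2E -[X in X <= _]expR0 ler_expR; apply: mulr_ge0; last exact: ltW (ln2_gt0 R).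
  by apply: mulr_ge0 (ler0n _ _); apply: divr_ge0; apply: ler0n.
have C0 : 0 <= C by apply: le_trans C1.
pose F : R := C * (2 ^ k)%:R ^+ (999 * k).
have F1 : 1 <= F.
  by apply: mulr_ege1 C1 _; apply: exprn_ege1; rewrite ler1n expn_gt0.
have hF (W : {set G}) : (#|W| <= D)%N -> (ncliques W)%:R <= F.
  move=> WD; apply: le_trans (ncliques_peel C1 _ (i := 999 * k) (V := W) (fintype.subxx W) _) _.
  - by move=> V M MV dV; apply: (ncliques_dense R t1 nT MV dV).
  - by apply: (@ltn_exp_ratio 999) => //; apply: leq_ltn_trans Dk.
  - apply: ler_wpM2l C0 _ _ _; apply: lerXn2r; rewrite ?nnegrE ?ler0n // ler_nat.
    by apply: leq_ltn_trans Dk.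
have hD (W : {set G}) : (0 < #|W|)%N -> exists2 v, v \in W & (deg (@adj G) W v <= D)%N.
  move=> W0; apply/exists_inP; apply: contraT => /exists_inPn h; case: nT.
  apply: (@subdivision_of_min_degree t G W (ltnW t1) W0) => v /h.
  by rewrite -ltnNge => /ltnW.
have := ncliques_degenerate hD hF [set: G]; rewrite ncliques_setT cardsT => h.
apply: le_trans h _.
have n1 : 1 <= #|G|%:R :> R by rewrite ler1n.
(* The empty clique is absorbed by doubling F; this is the 1 in the exponent 1 + 999 k^2. *)
apply: (@le_trans _ _ (2 * F * #|G|%:R)).
  have : 1 <= #|G|%:R * F by apply: mulr_ege1.
  by lra.
apply: ler_wpM2r (ler0n _ _) _ _ _.
rewrite powRD ?pnatr_eq0 ?implybT // -/C /F mulrCA; apply: ler_wpM2l C0 _ _ _.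
apply: (@le_trans _ _ (2 `^ (1 + 999 * k ^ 2)%N%:R)).
  rewrite powR_mulrn ?ler0n // -!natrX -natrM ler_nat -expnM -expnS.
  by rewrite leq_exp2l //; nia.
rewrite !powR2E ler_expR; apply: ler_wpM2r (ltW (ln2_gt0 R)) _ _ _.
by apply: cliques_eps_ge => //; apply: ltnW.
Qed.
End Bound.
Local Open Scope classical_set_scope.

Theorem theorem1p2 (R : realType) :
  exists eps : nat -> R,
    (eps t @[t --> \oo] --> (0 : R)) /\
    (forall (t n : nat) (G : sgraph),
       (1 <= t)%N -> (1 <= n)%N -> #|G| = n ->
       ~ has_subdivision (complete_graph t) G ->
       #|cliques G|%:R
         <= 2 `^ (1817 / 1000 * t%:R + eps t * t%:R) * n%:R).
Proof.
exists (@cliques_eps R); split; first exact: cliques_eps_cvg.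
move=> t n G + + Gn nT; rewrite -Gn leq_eqVlt => /orP [/eqP t1|t1] n1.
  by case: nT; rewrite -t1; apply: subdivision1.
exact: card_cliques_le.
Qed.
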